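(* Let $s$ be the convex function parameterizing some $Q\in\mathcal{M}_{\mathrm{div}}$ (i.e. $\operatorname{Hess}(s)=R^TQR$), let $\mathcal{V}$ be a finite set of points $(x_i,y_i)\in\Omega$, not all collinear, and let $s_i=s(x_i,y_i)$. For a triangulation $\mathcal{T}$ of $\mathcal{V}$ and values $u=(u_i)$ at the vertices, let $$E_{\mathcal{T}}(u)=\frac12\sum_{i\sim j}q^h_{ij}(u_i-u_j)^2$$ be the discrete Dirichlet energy, with $q^h_{ij}$ computed on $\mathcal{T}$ by the hinge formula from the $s_i$. Then for any given function $u_i$ (with $u_i=0$ at the vertices on the boundary of the triangulated region), $E_{\mathcal{T}}(u)$ is minimized over all triangulations $\mathcal{T}$ of $\mathcal{V}$ by the weighted Delaunay triangulation of $\mathcal{V}$ with weights $w_i=x_i^2+y_i^2-2s_i$.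
   Context: $\Omega$ is a bounded convex subset of $\mathbb{R}^2$ with $C^2$ boundary; $R=\begin{pmatrix}0&-1\\1&0\end{pmatrix}$. $\mathcal{M}$ is the space of uniformly elliptic, bounded, symmetric $2\times2$ matrix fields on $\Omega$. For $M\in\mathcal{M}$, its harmonic coordinates $F_M=(F_1,F_2):\Omega\to\Omega$ are the weak solutions of $\operatorname{div}(M\nabla F_i)=0$ in $\Omega$, $F_i(x)=x_i$ on $\partial\Omega$ (it is known that $F_M$ is a homeomorphism with $\det\nabla F_M>0$ a.e.); convention $(\nabla F)_{ij}=\partial_iF_j$. $\mathcal{M}_{\mathrm{div}}$ is the set of all matrix fields $\frac{(\nabla F_M)^TM\nabla F_M}{\det(\nabla F_M)}\circ F_M^{-1}$, $M\in\mathcal{M}$. Each $Q\in\mathcal{M}_{\mathrm{div}}$ has a convex $s\in W^{2,1}(\Omega)$, unique up to affine functions, with $\operatorname{Hess}(s)=R^TQR$; the determinant of $\operatorname{Hess}(s)$ is uniformly bounded away from $0$ and $\infty$. The sum over $i\sim j$ is over edges of the triangulation; $q^h_{ij}$ is defined for interior edges (shared by two triangles $t_{ijk}$, $t_{ijl}$) by the hinge formula $$q^h_{ij}=-\frac{\cot\theta_{ijk}+\cot\theta_{ijl}}{|e_{ij}|^2}s_i-\frac{\cot\theta_{jik}+\cot\theta_{jil}}{|e_{ij}|^2}s_j+\frac{s_k}{2|t_{ijk}|}+\frac{s_l}{2|t_{ijl}|},$$ where $|e_{ij}|$ is the edge length, $|t_{ijk}|$ the area of the triangle $ijk$, and $\theta_{ijk}$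 its interior angle at vertex $j$. Boundary edges do not contribute, since $u$ vanishes at boundary vertices. A triangulation of $\mathcal{V}$ has vertex set $\mathcal{V}$ and covers the convex hull of $\mathcal{V}$. The weighted Delaunay triangulation of points $p_i$ with weights $w_i$ is the dual graph of the power diagram with cells $\{p:\ |p-p_i|^2-w_i\le|p-p_j|^2-w_j\ \forall j\}$ (degenerate cells being triangulated arbitrarily). *)

(* Defs.v *)
From HB Require Import structures.
From mathcomp Require Import all_boot all_order all_algebra.
From mathcomp Require Import all_classical all_reals all_analysis.

Set Implicit Arguments.
Unset Strict Implicit.
Unset Printing Implicit Defensive.

Import Order.TTheory GRing.Theory Num.Theory.
Import numFieldNormedType.Exports.

Local Open Scope classical_set_scope.
Local Open Scope ring_scope.

(* The norm of the product is the max norm; it is only used through its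
   topology and its bounded sets. *)
Notation plane R := (R * R)%type.

Section Plane.
Context {R : realType}.
Implicit Types x y : plane R.

Definition crd (i : 'I_2) x : R := if i == ord0 then x.1 else x.2.

Definition basis_vec (i : 'I_2) : plane R := ((i == ord0)%:R, (i != ord0)%:R).

Definition dot x y : R := x.1 * y.1 + x.2 * y.2.

Definition enorm x : R := Num.sqrt (dot x x).

Definition leb2 :
    {measure set (measurableTypeR R * measurableTypeR R) -> \bar R} :=
  (@lebesgue_measure R \x @lebesgue_measure R)%E.

Definition boundary (A : set (plane R)) : set (plane R) :=
  closure A `\` A°.

Definition rot90 : 'M[R]_2 :=
  \matrix_(i, j) (if (i == 0) && (j == 1) then - 1
                  else if (i == 1) && (j == 0) then 1 else 0).

End Plane.

Section Domain.
Context {R : realType}.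
Implicit Types (U Omega : set (plane R)) (f : plane R -> R).

Fixpoint Ck (k : nat) U f : Prop :=
  match k with
  | 0 => {within U, continuous f}
  | k'.+1 => {within U, continuous f} /\
      forall i, (forall x, U x -> derivable f x (basis_vec i)) /\
                Ck k' U ('D_(basis_vec i) f)
  end.

Definition C2_boundary Omega : Prop :=
  forall x, boundary Omega x ->
  exists U (rho : plane R -> R),
    [/\ open U, U x, Ck 2 U rho, exists i, 'D_(basis_vec i) rho x != 0
      & Omega `&` U = [set y | U y /\ rho y < 0]].

Definition convex_C2_domain Omega : Prop :=
  [/\ open Omega, bounded_set Omega, convex_set Omega & C2_boundary Omega].

Definition test_function Omega f : Prop :=
  [/\ forall k, Ck k setT f, compact (closure [set x | f x != 0])
    & closure [set x | f x != 0] `<=` Omega].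

End Domain.

Section Sobolev.
Context {R : realType}.
Implicit Types (Omega : set (plane R)) (f : plane R -> R)
  (Df : 'I_2 -> plane R -> R).

Definition Lp_norm (p : R) Omega f : \bar R :=
  Lnorm leb2 p%:E (EFin \o (f \_ Omega)).

Definition in_Lp (p : R) Omega f : Prop := f \_ Omega \in Lfun leb2 p%:E.

Definition weak_partial Omega (i : 'I_2) f (g : plane R -> R) : Prop :=
  forall phi : plane R -> R, test_function Omega phi ->
    \int[leb2]_(x in Omega) (f x * 'D_(basis_vec i) phi x) =
    - \int[leb2]_(x in Omega) (g x * phi x).

(* [f] belongs to W^{1,p}(Omega), with weak partial derivatives [Df i]. *)
Definition sobolev1 (p : R) Omega f Df : Prop :=
  in_Lp p Omega f /\
  forall i, in_Lp p Omega (Df i) /\ weak_partial Omega i f (Df i).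

(* [f] belongs to W^{2,p}(Omega), with weak Hessian [H]. *)
Definition sobolev2 (p : R) Omega f (H : plane R -> 'M[R]_2) : Prop :=
  exists Df, sobolev1 p Omega f Df /\
    forall j, sobolev1 p Omega (Df j) (fun i x => H x i j).

(* [f], with weak partial derivatives [Df i], belongs to H^1_0(Omega), the
   closure of the test functions in W^{1,2}(Omega). *)
Definition sobolev10 Omega f Df : Prop :=
  sobolev1 2 Omega f Df /\
  exists phi : nat -> plane R -> R,
    [/\ forall m, test_function Omega (phi m),
        Lp_norm 2 Omega (f \- phi m) @[m --> \oo] --> 0%E
      & forall i, Lp_norm 2 Omega (Df i \- 'D_(basis_vec i) (phi m))
                    @[m --> \oo] --> 0%E].

End Sobolev.

Section Harmonic.
Context {R : realType}.
Implicit Types (Omega : set (plane R)) (M Q DF : plane R -> 'M[R]_2)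
  (F : plane R -> plane R).

Definition elliptic_field Omega M : Prop :=
  (forall i j, measurable_fun Omega (fun x => M x i j)) /\
  exists a b : R, 0 < a /\
    {ae leb2, forall x, Omega x ->
      [/\ (M x)^T = M x,
          forall xi : 'cV[R]_2,
            a * (xi^T *m xi) 0 0 <= (xi^T *m M x *m xi) 0 0
        & forall i j, `|M x i j| <= b]}.

(* [DF x] is the matrix with entries [DF x i j = partial_i F_j (x)], so that
   column [j] of [M x *m DF x] is the flux of [F_j]. *)
Definition harmonic_coordinates Omega M F DF : Prop :=
  [/\ forall j, sobolev1 2 Omega (crd j \o F) (fun i x => DF x i j),
      forall j (phi : plane R -> R), test_function Omega phi ->
        \int[leb2]_(x in Omega)
          (\sum_i (M x *m DF x) i j * 'D_(basis_vec i) phi x) = 0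
    & forall j, sobolev10 Omega (fun x => crd j (F x) - crd j x)
                  (fun i x => DF x i j - (i == j)%:R)].

Definition homeo_of Omega F (G : plane R -> plane R) : Prop :=
  [/\ {within Omega, continuous F}, {within Omega, continuous G},
      set_fun Omega Omega F, set_fun Omega Omega G
    & forall x, Omega x -> G (F x) = x /\ F (G x) = x].

(* Harmonic coordinates are determined up to null sets; the continuous
   representative [F] is the homeomorphism that is inverted. *)
Definition Mdiv Omega Q : Prop :=
  exists M F DF G,
    [/\ elliptic_field Omega M, harmonic_coordinates Omega M F DF,
        homeo_of Omega F G
      & {ae leb2, forall x, Omega x ->
          Q x = (\det (DF (G x)))^-1 *:
                ((DF (G x))^T *m M (G x) *m DF (G x))}].

Definition parametrizes Omega Q (s : plane R -> R) : Prop :=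
  convex_function Omega s /\
  exists H, sobolev2 1 Omega s H /\
    {ae leb2, forall x, Omega x -> H x = rot90^T *m Q x *m rot90}.

End Harmonic.

Section Triangulation.
Context {R : realType} {n : nat}.
Variable p : 'I_n -> plane R.
Implicit Types (A t : {set 'I_n}) (T : {set {set 'I_n}}) (w s u : 'I_n -> R).

Definition collinear A : Prop :=
  exists a b c : R, (a != 0) || (b != 0) /\
    forall i, i \in A -> a * (p i).1 + b * (p i).2 = c.

Definition hull A : set (plane R) :=
  [set x | exists l : 'I_n -> R,
    [/\ forall i, 0 <= l i, forall i, i \notin A -> l i = 0,
        \sum_i l i = 1 & x = \sum_i l i *: p i]].

(* A triangulation is given by the vertex sets of its triangles. *)
Definition triangulation T : Prop :=
  [/\ forall t, t \in T -> #|t| = 3%N /\ ~ collinear t,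
      forall t t', t \in T -> t' \in T ->
        hull t `&` hull t' = hull (t :&: t'),
      forall i, exists2 t, t \in T & i \in t
    & \bigcup_(t in [set` T]) hull t = hull [set: 'I_n]].

Definition edge T (i j : 'I_n) : Prop :=
  i != j /\ exists2 t, t \in T & [set i; j]%SET \subset t.

Definition power_cell w (i : 'I_n) : set (plane R) :=
  [set x | forall j, enorm (x - p i) ^+ 2 - w i <= enorm (x - p j) ^+ 2 - w j].

(* Adjacency in the dual graph of the power diagram: the two cells share a
   nondegenerate segment. *)
Definition power_adjacent w (i j : 'I_n) : Prop :=
  i != j /\ exists x y, [/\ x != y,
    (power_cell w i `&` power_cell w j) x &
    (power_cell w i `&` power_cell w j) y].

(* The edges of the dual graph are edges of [T], and every triangle of [T] is
   spanned by vertices of the face of the dual graph that corresponds to some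
   point [x] of the power diagram.  This face is itself a triangle, unless more
   than three cells meet at [x], in which case its triangulation is free. *)
Definition weighted_Delaunay w T : Prop :=
  [/\ triangulation T,
      forall i j, power_adjacent w i j -> edge T i j
    & forall t, t \in T ->
        exists x, forall i, i \in t -> power_cell w i x].

(* The interior angle at [b] of the triangle [a b c]. *)
Definition angle (a b c : plane R) : R :=
  acos (dot (a - b) (c - b) / (enorm (a - b) * enorm (c - b))).

Definition cot (x : R) : R := cos x / sin x.

Definition area (a b c : plane R) : R :=
  `|(b.1 - a.1) * (c.2 - a.2) - (b.2 - a.2) * (c.1 - a.1)| / 2.

(* [q^h_ij], for the edge [ij] shared by the triangles [ijk] and [ijl]. *)
Definition hinge s (i j k l : 'I_n) : R :=
  - ((cot (angle (p i) (p j) (p k)) + cot (angle (p i) (p j) (p l)))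
     / enorm (p i - p j) ^+ 2) * s i
  - ((cot (angle (p j) (p i) (p k)) + cot (angle (p j) (p i) (p l)))
     / enorm (p i - p j) ^+ 2) * s j
  + s k / (2 * area (p i) (p j) (p k))
  + s l / (2 * area (p i) (p j) (p l)).

(* An interior edge of a triangulation lies in exactly two triangles, so with
   [i < j] and [k < l] each interior edge contributes exactly one term, and
   boundary edges contribute none. *)
Definition dirichlet_energy s T u : R :=
  2^-1 * \sum_(i < n) \sum_(j < n | (i < j)%N)
    \sum_(k < n) \sum_(l < n | [&& (k < l)%N, [set i; j; k]%SET \in T
                                  & [set i; j; l]%SET \in T])
      hinge s i j k l * (u i - u j) ^+ 2.

End Triangulation.

(* Main.v *)
Require Import Defs.
From mathcomp Require Import all_boot all_order all_algebra.
From mathcomp Require Import all_classical all_reals all_analysis.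
From mathcomp Require Import ring lra.

Import Order.TTheory GRing.Theory Num.Theory.
Import numFieldNormedType.Exports.

Local Open Scope classical_set_scope.
Local Open Scope ring_scope.

(** The theorem is proved by Lawson flips. The hinge weight of an edge is the
    crease, divided by the length of the edge, that the piecewise linear
    interpolant of the values [s] has along it. When a convex quadrilateral is
    cut by its other diagonal, the weights of its five edges change in such a
    way that the energy drops by
    [delta(s) * delta(u) ^ 2 / (2 * A * B * C * D)], where [delta] is the
    determinant of the four lifted vertices and [A], [B], [C], [D] are the
    doubled areas of the four triangles that two consecutive sides span
    ([flip_energy]); the integral of the interpolant drops by a positive
    multiple of [delta(s)] ([flip_volume]). So a flip across an edge along which
    the interpolant is not convex lowers the integral without raising the energy,
    and such a flip is always possible: since the values [s] are in convex
    position, the two triangles at such an edge form a strictly convex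
    quadrilateral ([concave_convex_quad], [flip_triangulation]).

    Given a triangulation, choose among those that do not exceed its energy one
    whose interpolant has the least integral. Its interpolant is convex across
    every edge, hence it is the convex envelope of the values: the affine
    function of each triangle stays below all the values
    ([convex_across_edges_supported]). For the weighted Delaunay triangulation
    the same holds, the point common to the power cells of a triangle being the
    gradient of its affine function ([Delaunay_supported]). Finally two
    triangulations that both carry the convex envelope have the same creases,
    hence the same energy, whatever the way in which they cut the flat faces of
    the envelope ([supported_energy]).

    Both the flip and the comparison of creases use the energy in other forms: as
    a sum over triangles, resp. over edges with one weight each. Passing to
    these forms from the sum over pairs of adjacent triangles uses that [u]
    vanishes on the boundary: an edge with [u i != u j] lies in exactly two
    triangles, one on each side ([edge_two_triangles]). *)

(** * Orientation and the hinge weights *)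

Section Orientation.
Context {R : realType}.
Implicit Types a b c d x y : plane R.

(** Twice the signed area of a triangle, positive when it is counterclockwise. *)
Definition orient a b c : R :=
  (b.1 - a.1) * (c.2 - a.2) - (b.2 - a.2) * (c.1 - a.1).

Lemma orient_rot a b c : orient a b c = orient b c a.
Proof. rewrite /orient; ring. Qed.

Lemma orient_swap a b c : orient b a c = - orient a b c.
Proof. rewrite /orient; ring. Qed.

Lemma orient_swap_last a b c : orient a c b = - orient a b c.
Proof. rewrite /orient; ring. Qed.

Lemma area_orient a b c : 2 * area a b c = `|orient a b c|.
Proof. by rewrite /area mulrCA divff ?mulr1 ?pnatr_eq0. Qed.

Lemma enorm2 x : enorm x ^+ 2 = dot x x.
Proof. by rewrite /enorm sqr_sqrtr // /dot -!expr2 addr_ge0 ?sqr_ge0. Qed.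

Lemma orient_dot a b c :
  orient a b c ^+ 2 = dot (a - b) (a - b) * dot (c - b) (c - b)
                      - dot (a - b) (c - b) ^+ 2.
Proof. rewrite /orient /dot /=; ring. Qed.

Lemma orient_neq0_dot a b c : orient a b c != 0 -> 0 < dot (a - b) (a - b).
Proof.
move=> o0; rewrite lt_neqAle eq_sym andbC {1}/dot -!expr2 addr_ge0 ?sqr_ge0 //=.
apply: contraNneq o0; rewrite /dot -!expr2 => /eqP.
rewrite paddr_eq0 ?sqr_ge0// !sqrf_eq0 /= !subr_eq0 => /andP[/eqP e1 /eqP e2].
by rewrite /orient e1 e2; apply/eqP; ring.
Qed.

(** By [orient_dot], the sine of the angle is [`|orient a b c|] over the product
    of the lengths of the two sides. *)
Lemma cot_angle a b c : orient a b c != 0 ->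
  cot (angle a b c) = dot (a - b) (c - b) / `|orient a b c|.
Proof.
move=> o0.
have ab0 := orient_neq0_dot _ _ _ o0.
have cb0 : 0 < dot (c - b) (c - b).
  by apply: (orient_neq0_dot c b a); rewrite -orient_rot orient_swap oppr_eq0 orient_rot.
set D := dot (a - b) (c - b).
set N := enorm (a - b) * enorm (c - b).
have N0 : 0 < N by rewrite mulr_gt0 // sqrtr_gt0.
have N2 : N ^+ 2 = dot (a - b) (a - b) * dot (c - b) (c - b).
  by rewrite exprMn !enorm2.
have o2 : orient a b c ^+ 2 = N ^+ 2 - D ^+ 2 by rewrite N2 orient_dot.
have sinE : 1 - (D / N) ^+ 2 = (`|orient a b c| / N) ^+ 2.
  rewrite !expr_div_n real_normK ?num_real // o2 mulrBl divff //.
  by rewrite expf_neq0 // gt_eqF.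
have D1 : -1 <= D / N <= 1.
  rewrite -ler_norml -(@ler_pXn2r _ 2) ?nnegrE // expr1n.
  by rewrite real_normK ?num_real // -subr_ge0 sinE sqr_ge0.
rewrite /cot /angle -/D -/N acosK ?in_itv//= sin_acos // sinE sqrtr_sqr.
rewrite ger0_norm ?divr_ge0 // ?(ltW N0)//.
have n0 : `|orient a b c| != 0 by rewrite normr_eq0.
by field; rewrite n0 gt_eqF.
Qed.

(** Affine functions on the plane, as a value at the origin and a gradient. *)
Definition aval (L : R * plane R) x : R := L.1 + dot L.2 x.

Definition aff_orient a b : R * plane R :=
  (orient a b (0, 0), (a.2 - b.2, b.1 - a.1)).

Lemma aff_orientE a b x : aval (aff_orient a b) x = orient a b x.
Proof. rewrite /aval /aff_orient /orient /dot /=; ring. Qed.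

Lemma aval_line L x y (d : R) :
  aval L (x + d *: (y - x)) = (1 - d) * aval L x + d * aval L y.
Proof. rewrite /aval /dot /= /GRing.scale /=; ring. Qed.

Lemma orient_line a b x y (d : R) :
  orient a b (x + d *: (y - x)) = (1 - d) * orient a b x + d * orient a b y.
Proof. by rewrite -!aff_orientE aval_line. Qed.

End Orientation.

Section FourPoints.
Context {R : realType} {n : nat}.
Variable p : 'I_n -> plane R.
Implicit Types (s u : 'I_n -> R) (i j k l : 'I_n).

Local Notation o i j k := (orient (p i) (p j) (p k)).

(** The value at [k] minus the value, at the foot of the altitude from [k], of the
    linear interpolation along the line [i j]. *)
Definition foot_excess s i j k : R :=
  s k - (s i * dot (p i - p j) (p k - p j) + s j * dot (p j - p i) (p k - p i))
        / dot (p i - p j) (p i - p j).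

(** The share of one triangle in the hinge weight: the derivative of the
    interpolant along the inner normal of the edge [i j], over its length. *)
Definition half_hinge s i j k : R := foot_excess s i j k / `|o i j k|.

Lemma hingeE s i j k l : o i j k != 0 -> o i j l != 0 ->
  hinge p s i j k l = half_hinge s i j k + half_hinge s i j l.
Proof.
move=> ok ol; rewrite /hinge /half_hinge /foot_excess !area_orient.
rewrite enorm2 !cot_angle -?/(o _ _ _) // 1?orient_swap ?oppr_eq0 //.
rewrite (orient_swap (p i) (p j) (p k)) (orient_swap (p i) (p j) (p l)) !normrN.
have e0 : dot (p i - p j) (p i - p j) != 0.
  by rewrite gt_eqF // (orient_neq0_dot _ _ (p k)).
have nk : `|o i j k| != 0 by rewrite normr_eq0.
have nl : `|o i j l| != 0 by rewrite normr_eq0.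
by field; rewrite e0 nk nl.
Qed.

Lemma foot_excessC s i j k : foot_excess s j i k = foot_excess s i j k.
Proof.
rewrite /foot_excess (_ : dot (p j - p i) (p j - p i) = dot (p i - p j) (p i - p j)).
  by rewrite [_ + s i * _]addrC.
rewrite /dot /=; ring.
Qed.

Lemma half_hingeC s i j k : half_hinge s i j k = half_hinge s j i k.
Proof.
by rewrite /half_hinge foot_excessC orient_swap normrN.
Qed.

(** The determinant of the four vertices lifted by [s]: it vanishes on affine [s],
    and its sign tells on which side of the lifted plane [i j k] the vertex [l] is
    lifted. *)
Definition lift_det s i j k l : R :=
  s i * o j k l - s j * o i k l + s k * o i j l - s l * o i j k.

(** Both sides are linear in [s] and vanish on affine functions, so they are
    proportional; the factor is read off at [s k]. In particular the length of the
    edge [i j] drops out. *)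
Lemma foot_excessB s i j k l : o i j k != 0 -> o i j l != 0 ->
  foot_excess s i j k / o i j k - foot_excess s i j l / o i j l
  = lift_det s i j k l / (o i j k * o i j l).
Proof.
move=> ok ol; have := orient_neq0_dot _ _ _ ok => /lt0r_neq0.
move: ok ol; rewrite /foot_excess /lift_det /orient /dot /= => ok ol e0.
by field; rewrite ?ok ?ol ?e0.
Qed.

Lemma lift_det_affine L i j k l : lift_det (fun v => aval L (p v)) i j k l = 0.
Proof. rewrite /lift_det /aval /orient /dot /=; ring. Qed.

(** So [s] can be normalized to vanish where an affine function touches it. *)
Lemma lift_det_touch L s i j k l :
  lift_det s i j k l = lift_det (fun v => s v - aval L (p v)) i j k l.
Proof.
rewrite -[LHS]subr0 -(lift_det_affine L i j k l) /lift_det; ring.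
Qed.

(** The part of twice the energy that a triangle contributes: the energy splits
    over triangles since each crease is the sum of two normal derivatives. *)
Definition triangle_energy s u i j k : R :=
  half_hinge s i j k * (u i - u j) ^+ 2 + half_hinge s j k i * (u j - u k) ^+ 2
  + half_hinge s k i j * (u k - u i) ^+ 2.

Lemma half_hinge_pos s i j k : 0 < o i j k ->
  half_hinge s i j k = foot_excess s i j k / o i j k.
Proof. by move=> o0; rewrite /half_hinge gtr0_norm. Qed.

Lemma half_hinge_opp s i j k l : 0 < o i j k -> o i j l < 0 ->
  half_hinge s i j k + half_hinge s i j l
  = lift_det s i j k l / (o i j k * o i j l).
Proof.
move=> ok ol.
rewrite -(foot_excessB _ _ _ _ _ (lt0r_neq0 ok) (ltr0_neq0 ol)) /half_hinge.
by rewrite gtr0_norm // ltr0_norm // invrN mulrN.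
Qed.

Lemma half_hinge_same s i j k l : 0 < o i j k -> 0 < o i j l ->
  half_hinge s i j k - half_hinge s i j l
  = lift_det s i j k l / (o i j k * o i j l).
Proof.
by move=> ok ol; rewrite -foot_excessB ?gt_eqF // !half_hinge_pos.
Qed.

(** On each of the six edges the change of weight is a multiple of [lift_det s], by
    [half_hinge_opp] on the two diagonals and [half_hinge_same] on the four sides.
    What remains is a quadratic form in the four values of [u], which has to be
    the square of [lift_det u], up to the factor displayed. *)
Lemma flip_energy s u i j k l :
  0 < o i j k -> 0 < o j i l -> 0 < o i l k -> 0 < o j k l ->
  triangle_energy s u i j k + triangle_energy s u j i l
  - (triangle_energy s u i l k + triangle_energy s u j k l)
  = lift_det s i j k l * lift_det u i j k l ^+ 2
    / (o i j k * o j i l * o i l k * o j k l).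
Proof.
move=> A0 B0 C0 D0.
have o_rot a b c : o b c a = o a b c by rewrite -orient_rot.
have o_swap a b c : o b a c = - o a b c by rewrite orient_swap.
have Eij : half_hinge s i j k + half_hinge s i j l
    = - (lift_det s i j k l / (o i j k * o j i l)).
  have B1 : o i j l < 0 by rewrite -oppr_gt0 -o_swap.
  by rewrite half_hinge_opp // (o_swap i) mulrN invrN mulrN opprK.
have lki : o l k i = o i l k by rewrite o_rot.
have ljk : o l k j = - o j k l by rewrite -o_rot o_swap o_rot.
have kij : o k i j = o i j k by rewrite o_rot.
have kil : o k i l = o i l k by rewrite -o_rot.
have jki : o j k i = o i j k by rewrite o_rot.
have ilj : o i l j = o j i l by rewrite o_rot.
have lji : o l j i = o j i l by rewrite -o_rot.
have ljk' : o l j k = o j k l by rewrite -o_rot.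
have Ekl : half_hinge s l k i + half_hinge s l k j
    = lift_det s i j k l / (o i l k * o j k l).
  have Sl : lift_det s l k i j = - lift_det s i j k l.
    by rewrite /lift_det /orient; ring.
  have lki0 : 0 < o l k i by rewrite lki.
  have ljk0 : o l k j < 0 by rewrite ljk oppr_lt0.
  by rewrite half_hinge_opp // Sl lki ljk mulrN invrN mulrNN.
have same a b c d : 0 < o a b c -> 0 < o a b d ->
    lift_det s a b c d = lift_det s i j k l ->
    half_hinge s a b c - half_hinge s a b d
    = lift_det s i j k l / (o a b c * o a b d).
  by move=> c0 d0 <-; rewrite half_hinge_same.
have Eki : half_hinge s k i j - half_hinge s k i l
    = lift_det s i j k l / (o i j k * o i l k).
  rewrite same ?kij ?kil //; rewrite /lift_det /orient; ring.
have Ejk : half_hinge s j k i - half_hinge s j k l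
    = lift_det s i j k l / (o i j k * o j k l).
  rewrite same ?jki //; rewrite /lift_det /orient; ring.
have Eil : half_hinge s i l j - half_hinge s i l k
    = lift_det s i j k l / (o j i l * o i l k).
  rewrite same ?ilj //; rewrite /lift_det /orient; ring.
have Elj : half_hinge s l j i - half_hinge s l j k
    = lift_det s i j k l / (o j i l * o j k l).
  rewrite same ?lji ?ljk' //; rewrite /lift_det /orient; ring.
set S := lift_det s i j k l in Eij Ekl Eki Ejk Eil Elj *.
have -> : triangle_energy s u i j k + triangle_energy s u j i l
    - (triangle_energy s u i l k + triangle_energy s u j k l)
  = - (S / (o i j k * o j i l)) * (u i - u j) ^+ 2
    - S / (o i l k * o j k l) * (u k - u l) ^+ 2
    + S / (o i j k * o i l k) * (u k - u i) ^+ 2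
    + S / (o i j k * o j k l) * (u j - u k) ^+ 2
    + S / (o j i l * o i l k) * (u i - u l) ^+ 2
    + S / (o j i l * o j k l) * (u l - u j) ^+ 2.
  rewrite -Eij -Ekl -Eki -Ejk -Eil -Elj /triangle_energy.
  rewrite (half_hingeC s j i l) (half_hingeC s k l j); ring.
have -> : lift_det u i j k l
    = u i * o j k l + u j * o i l k - u k * o j i l - u l * o i j k.
  by rewrite /lift_det /orient; ring.
have Dsum : o j k l = o i j k + o j i l - o i l k by rewrite /orient; ring.
have A' := lt0r_neq0 A0; have B' := lt0r_neq0 B0.
have C' := lt0r_neq0 C0; have D' := lt0r_neq0 D0.
move: A' B' C' D' Dsum {A0 B0 C0 D0 Eij Ekl Eki Ejk Eil Elj same}.
move: (o i j k) (o j i l) (o i l k) (o j k l) => A B C D A0 B0 C0 D0 DE.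
rewrite DE in D0 *; field.
by rewrite A0 B0 C0 D0.
Qed.
End FourPoints.

(** * Convex hulls of vertices *)

Section Hulls.
Context {R : realType} {n : nat}.
Variable p : 'I_n -> plane R.
Implicit Types (A B : {set 'I_n}) (i j k l : 'I_n) (x y : plane R)
  (L : R * plane R).

Local Notation o i j k := (orient (p i) (p j) (p k)).

Lemma aval_sum L (w : 'I_n -> R) : \sum_v w v = 1 ->
  aval L (\sum_v w v *: p v) = \sum_v w v * aval L (p v).
Proof.
move=> w1.
have E1 : (\sum_v w v *: p v).1 = \sum_v w v * (p v).1.
  by rewrite (big_morph (fun x : plane R => x.1) (id1 := 0) (op1 := +%R)).
have E2 : (\sum_v w v *: p v).2 = \sum_v w v * (p v).2.
  by rewrite (big_morph (fun x : plane R => x.2) (id1 := 0) (op1 := +%R)).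
rewrite /aval /dot E1 E2 -[L.1 in LHS]mulr1 -w1 !mulr_sumr -!big_split /=.
by apply: eq_bigr => v _; ring.
Qed.

Lemma plane_eq x y : (forall L, aval L x = aval L y) -> x = y.
Proof.
move=> E; move: (E (0, (1, 0))) (E (0, (0, 1))); rewrite /aval /dot /=.
by case: x {E} => ? ?; case: y => ? ? /=; rewrite !mul1r !mul0r !addr0 !add0r => -> ->.
Qed.

Lemma sum_support A (w f : 'I_n -> R) : (forall v, v \notin A -> w v = 0) ->
  \sum_v w v * f v = \sum_(v in A) w v * f v.
Proof.
move=> w0; rewrite (bigID (mem A)) /= [X in _ + X]big1 ?addr0 // => v vA.
by rewrite w0 ?mul0r.
Qed.

Lemma hullS A B : A \subset B -> hull p A `<=` hull p B.
Proof.
move=> /fintype.subsetP AB x [w [w0 wA w1 xE]]; exists w; split=> // v vB.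
by apply: wA; apply: contra vB; apply: AB.
Qed.

Lemma hull_vertex A i : i \in A -> hull p A (p i).
Proof.
move=> iA; exists (fun v => (v == i)%:R); split.
- by move=> v; case: eqP.
- by move=> v vA; case: eqP => // E; rewrite E iA in vA.
- by rewrite (bigD1 i) //= eqxx big1 ?addr0 // => v /negPf ->.
- rewrite (bigD1 i) //= eqxx scale1r big1 ?addr0 // => v /negPf ->.
  by rewrite scale0r.
Qed.

Lemma hull_line A x y (d : R) : 0 <= d <= 1 -> hull p A x -> hull p A y ->
  hull p A (x + d *: (y - x)).
Proof.
move=> /andP[d0 d1] [w [w0 wA w1 ->]] [w' [w0' wA' w1' ->]].
exists (fun v => (1 - d) * w v + d * w' v); split.
- by move=> v; rewrite addr_ge0 // mulr_ge0 // subr_ge0.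
- by move=> v vA; rewrite wA ?wA' // !mulr0 addr0.
- by rewrite big_split /= -!mulr_sumr w1 w1' !mulr1 subrK.
apply: plane_eq => L; rewrite aval_line !aval_sum //; last first.
  by rewrite big_split /= -!mulr_sumr w1 w1' !mulr1 subrK.
by rewrite !mulr_sumr -big_split /=; apply: eq_bigr => v _; ring.
Qed.

(** Points of a hull are used through the affine functions evaluated at them. *)
Lemma hull_aval A x : hull p A x ->
  exists w : 'I_n -> R, [/\ forall v, 0 <= w v, forall v, v \notin A -> w v = 0,
    \sum_v w v = 1 & forall L, aval L x = \sum_v w v * aval L (p v)].
Proof.
by move=> [w [w0 wA w1 ->]]; exists w; split=> // L; rewrite aval_sum.
Qed.

Lemma hull3_aval i j k x : i != j -> j != k -> i != k ->
  hull p [set i; j; k]%SET x ->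
  exists a b c : R, [/\ 0 <= a, 0 <= b, 0 <= c, a + b + c = 1 &
    forall L, aval L x = a * aval L (p i) + b * aval L (p j) + c * aval L (p k)].
Proof.
move=> ij jk ik /hull_aval[w [w0 wA w1 wE]].
have S3 (f : 'I_n -> R) : \sum_v w v * f v = w i * f i + w j * f j + w k * f k.
  rewrite (sum_support [set i; j; k]%SET) // finset.setUC.
  rewrite !big_setU1 ?big_set1 1?addrC //= !inE ?negb_or.
    exact: ij.
  by rewrite ![k == _]eq_sym ik jk.
exists (w i), (w j), (w k); split=> // [|L]; last by rewrite wE S3.
by have := S3 (fun=> 1); under eq_bigr do rewrite mulr1; rewrite w1 !mulr1 => <-.
Qed.

Lemma hull3I i j k x (a b c : R) : 0 <= a -> 0 <= b -> 0 <= c -> a + b + c = 1 ->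
  (forall L, aval L x = a * aval L (p i) + b * aval L (p j) + c * aval L (p k)) ->
  hull p [set i; j; k]%SET x.
Proof.
move=> a0 b0 c0 abc E.
pose w v := a * (v == i)%:R + b * (v == j)%:R + c * (v == k)%:R : R.
have Sw (f : 'I_n -> R) : \sum_v w v * f v = a * f i + b * f j + c * f k.
  have S1 (h : R) m : \sum_v h * (v == m)%:R * f v = h * f m.
    rewrite (bigD1 m) //= eqxx mulr1 big1 ?addr0 // => v /negPf ->.
    by rewrite mulr0 mul0r.
  by rewrite -!S1 -!big_split /=; apply: eq_bigr => v _; rewrite /w; ring.
have w1 : \sum_v w v = 1.
  by have := Sw (fun=> 1); under eq_bigr do rewrite mulr1; rewrite !mulr1 abc.
exists w; split=> //.
- by move=> v; rewrite !addr_ge0 ?mulr_ge0 ?ler0n.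
- move=> v; rewrite !inE !negb_or => /andP[/andP[/negPf vi /negPf vj] /negPf vk].
  by rewrite /w vi vj vk !mulr0 !addr0.
- by apply: plane_eq => L; rewrite aval_sum // Sw E.
Qed.

Lemma orient_neq i j k : o i j k != 0 -> [/\ i != j, j != k & i != k].
Proof.
move=> o0; split; apply: contraNneq o0 => ->; apply/eqP; rewrite /orient; ring.
Qed.

(** Up to the area of the triangle, the three orientations are the barycentric
    coordinates of [x]. *)
Lemma hull3_orient i j k x : 0 < o i j k ->
  hull p [set i; j; k]%SET x <->
  [/\ 0 <= orient (p i) (p j) x, 0 <= orient (p j) (p k) x
    & 0 <= orient (p k) (p i) x].
Proof.
move=> o0; have [ij jk ik] := orient_neq _ _ _ (lt0r_neq0 o0); split.
  move=> /hull3_aval[]// a [b [c [a0 b0 c0 _ E]]].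
  rewrite -!aff_orientE !E !aff_orientE.
  have z (u v : plane R) : orient u v u = 0 by rewrite /orient; ring.
  have z' (u v : plane R) : orient u v v = 0 by rewrite /orient; ring.
  rewrite !z !z' (orient_rot (p k)) -(orient_rot (p i)).
  by split; rewrite !mulr0 ?add0r ?addr0 mulr_ge0 // ltW.
move=> [ok oi oj].
pose a := orient (p j) (p k) x / o i j k.
pose b := orient (p k) (p i) x / o i j k.
pose c := orient (p i) (p j) x / o i j k.
apply: (@hull3I i j k x a b c); rewrite /a /b /c ?divr_ge0 ?(ltW o0) //.
  have o0' := lt0r_neq0 o0; rewrite -!mulrDl (_ : _ + _ = o i j k) ?divff //.
  by rewrite /orient; ring.
move=> L; have o0' := lt0r_neq0 o0.
rewrite /aval /dot; move: o0'; rewrite /orient => o0'; field.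
by rewrite o0'.
Qed.

Lemma orient_noncollinear i j k :
  o i j k != 0 <-> ~ collinear p [set i; j; k]%SET.
Proof.
split.
  move=> o0 [a [b [c [ab E]]]].
  have := E i; have := E j; have := E k; rewrite !inE !eqxx !orbT /=.
  move=> /(_ isT) Ek /(_ isT) Ej /(_ isT) Ei.
  have Ha : a * o i j k = 0.
    have -> : a * o i j k =
      (a * (p j).1 + b * (p j).2 - (a * (p i).1 + b * (p i).2)) * ((p k).2 - (p i).2)
      - ((p j).2 - (p i).2) * (a * (p k).1 + b * (p k).2 - (a * (p i).1 + b * (p i).2)).
      by rewrite /orient; ring.
    by rewrite Ei Ej Ek !subrr mul0r mulr0 subrr.
  have Hb : b * o i j k = 0.
    have -> : b * o i j k =
      ((p j).1 - (p i).1) * (a * (p k).1 + b * (p k).2 - (a * (p i).1 + b * (p i).2))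
      - (a * (p j).1 + b * (p j).2 - (a * (p i).1 + b * (p i).2)) * ((p k).1 - (p i).1).
      by rewrite /orient; ring.
    by rewrite Ei Ej Ek !subrr mul0r mulr0 subrr.
  move: Ha Hb => /eqP; rewrite mulf_eq0 (negPf o0) orbF => /eqP a0.
  move=> /eqP; rewrite mulf_eq0 (negPf o0) orbF => /eqP b0.
  by rewrite a0 b0 !eqxx in ab.
move=> nc; apply/negP => /eqP o0; apply: nc.
have line a b : (a != 0) || (b != 0) ->
    a * (p j).1 + b * (p j).2 = a * (p i).1 + b * (p i).2 ->
    a * (p k).1 + b * (p k).2 = a * (p i).1 + b * (p i).2 ->
    collinear p [set i; j; k]%SET.
  move=> ab Ej Ek; exists a, b, (a * (p i).1 + b * (p i).2); split=> // v.
  by rewrite !inE => /orP[/orP[]|] /eqP ->.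
have [d0|] := boolP (((p j).2 - (p i).2 != 0) || ((p i).1 - (p j).1 != 0)).
  apply: (line _ _ d0); first by ring.
  by apply/eqP; rewrite -subr_eq0 -oppr_eq0; apply/eqP; rewrite -[RHS]o0 /orient; ring.
rewrite negb_or !negbK !subr_eq0 => /andP[/eqP e2 /eqP e1].
have [d0|] := boolP (((p k).2 - (p i).2 != 0) || ((p i).1 - (p k).1 != 0)).
  by apply: (line _ _ d0); rewrite ?e1 ?e2; ring.
rewrite negb_or !negbK !subr_eq0 => /andP[/eqP e4 /eqP e3].
by apply: (line 1 0); rewrite ?oner_eq0 // !mul1r !mul0r !addr0.
Qed.

End Hulls.

(** * Local structure of triangulations *)

Section Germs.
Context {R : realType}.

Lemma near_line_gt0 (a b : R) : 0 < a ->
  \forall d \near 0^'+, 0 < (1 - d) * a + d * b.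
Proof.
move=> a0; have M0 : 0 < `|a - b| + 1 by rewrite ltr_wpDl.
near=> d.
have d0 : 0 < d by near: d; exact: nbhs_right_gt.
have dM : d < a / (`|a - b| + 1).
  by near: d; apply: nbhs_right_lt; rewrite divr_gt0.
rewrite ltr_pdivlMr // in dM.
rewrite (_ : _ + _ = a - d * (a - b)); last by ring.
rewrite subr_gt0; apply: le_lt_trans dM; apply: ler_wpM2l; first exact: ltW.
by rewrite (le_trans (ler_norm _)) // lerDl.
Unshelve. all: by end_near. Qed.

Lemma near_line_ge0_start (a b : R) :
  (\forall d \near 0^'+, 0 <= (1 - d) * a + d * b) -> 0 <= a.
Proof.
move=> H; rewrite leNgt; apply/negP; rewrite -oppr_gt0 => a0.
have := near_line_gt0 _ (- b) a0 => H'.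
have [d []] := filter_ex (filterI H H').
by rewrite !mulrN -opprD oppr_gt0 leNgt => /negP.
Qed.

Lemma near_line_ge0 (a b : R) :
  (\forall d \near 0^'+, 0 <= (1 - d) * a + d * b) \/
  (\forall d \near 0^'+, ~ 0 <= (1 - d) * a + d * b).
Proof.
have [a0|a0|<-] := ltgtP 0 a.
- by left; apply: filterS (near_line_gt0 a b a0) => d; exact: ltW.
- right; rewrite -oppr_gt0 in a0; have := near_line_gt0 _ (- b) a0.
  apply: filterS => d; rewrite !mulrN -opprD oppr_gt0 => h.
  by apply/negP; rewrite -ltNge.
have [b0|b0] := leP 0 b.
  left; apply: filterS (nbhs_right_gt 0) => d d0.
  by rewrite mulr0 add0r mulr_ge0 // ltW.
right; apply: filterS (nbhs_right_gt 0) => d d0.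
by rewrite mulr0 add0r; apply/negP; rewrite -ltNge nmulr_llt0.
Qed.

Lemma near_interior (A : set (plane R)) (x v : plane R) : nbhs x A ->
  \forall d \near 0^'+, A (x + d *: v).
Proof.
move=> xA.
have : (fun d : R => x + d *: v) @ 0^'+ --> x.
  apply: cvg_at_right_filter; rewrite -[X in _ --> X]addr0 -[X in _ + X](scale0r v).
  apply: cvgD; first exact: cvg_cst.
  by apply: cvgZr_tmp; exact: cvg_id.
exact.
Qed.

End Germs.

Section Structure.
Context {R : realType} {n : nat}.
Variables (p : 'I_n -> plane R) (T : {set {set 'I_n}}).
Hypothesis HT : triangulation p T.
Implicit Types (t A : {set 'I_n}) (i j k l : 'I_n) (x y : plane R)
  (L : R * plane R).

Local Notation o i j k := (orient (p i) (p j) (p k)).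

Lemma hull_ge0 A L x : hull p A x -> (forall v, v \in A -> 0 <= aval L (p v)) ->
  0 <= aval L x.
Proof.
move=> /hull_aval[w [w0 wA w1 ->]] L0; rewrite sumr_ge0 // => v _.
by have [/L0 vA|/wA ->] := boolP (v \in A); rewrite ?mul0r ?mulr_ge0.
Qed.

Lemma hull_eq0 A L x : hull p A x -> (forall v, v \in A -> aval L (p v) = 0) ->
  aval L x = 0.
Proof.
move=> /hull_aval[w [w0 wA w1 ->]] L0; rewrite big1 // => v _.
by have [/L0 ->|/wA ->] := boolP (v \in A); rewrite ?mul0r ?mulr0.
Qed.

Lemma tri_orient i j k : [set i; j; k]%SET \in T -> o i j k != 0.
Proof. by case: HT => H _ _ _ /H[_] /orient_noncollinear. Qed.

Lemma tri_edge t i j : t \in T -> i \in t -> j \in t -> i != j ->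
  exists k, t = [set i; j; k]%SET.
Proof.
case: HT => H _ _ _ /H[t3 _] it jt ij.
have jt' : j \in (t :\ i)%SET by rewrite !inE eq_sym ij.
have : #|((t :\ i) :\ j)%SET| == 1%N.
  by move: t3; rewrite (cardsD1 i) it (cardsD1 j (t :\ i)) jt' !add1n => -[->].
move=> /cards1P[k Ek]; exists k.
by rewrite -(finset.setD1K it) -(finset.setD1K jt') Ek -finset.setUA.
Qed.

Lemma set3_rot i j k : [set i; j; k]%SET = [set j; k; i]%SET.
Proof. by apply/setP => v; rewrite !inE -orbA orbC. Qed.

Lemma set3_swap i j k : [set j; i; k]%SET = [set i; j; k]%SET.
Proof. by rewrite (finset.setUC [set j]%SET). Qed.

Lemma tri_vertex t i : t \in T -> i \in t ->
  exists j k, t = [set i; j; k]%SET /\ 0 < o i j k.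
Proof.
move=> tT it; case: HT => H _ _ _; have [t3 _] := H _ tT.
have : (t :\ i)%SET != finset.set0.
  by rewrite -card_gt0; move: t3; rewrite (cardsD1 i) it add1n => -[->].
move=> /set0Pn[j]; rewrite !inE => /andP[ji jt].
have [k tE] : exists k, t = [set i; j; k]%SET by apply: tri_edge; rewrite // eq_sym.
have : o i j k != 0 by apply: tri_orient; rewrite -tE.
rewrite neq_lt => /orP[neg|pos]; last by exists j, k.
exists k, j; split; last by rewrite orient_swap_last oppr_gt0.
by rewrite tE set3_rot set3_rot set3_swap.
Qed.

(** A vertex [i] of some triangle is an extreme point of it, so it cannot lie in the
    hull of the other vertices of that triangle, where the second condition on
    triangulations would put it. *)
Lemma hull_tri_vertex t i : t \in T -> hull p t (p i) -> i \in t.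
Proof.
move=> tT tpi; case: HT => _ HI HV _.
have [t' t'T it'] := HV i.
have [j [k [t'E o0]]] := tri_vertex _ _ t'T it'.
have := HI _ _ tT t'T; move=> /(congr1 (@^~ (p i))) E.
have {E} : hull p (t :&: t')%SET (p i).
  by rewrite -E; split => //; apply: hull_vertex.
move=> h; apply/negPn/negP => it.
have := hull_eq0 _ (aff_orient (p j) (p k)) _ h.
rewrite aff_orientE -orient_rot => H.
suff : o i j k = 0 by apply/eqP; rewrite gt_eqF.
apply: H => v; rewrite t'E !inE => /andP[vt /orP[/orP[]|] /eqP vE].
- by rewrite -vE vt in it.
- by rewrite aff_orientE vE /orient; ring.
- by rewrite aff_orientE vE /orient; ring.
Qed.

(** Two triangles lying on the same side of a common edge overlap near its
    midpoint, outside the edge. *)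
Lemma same_side_eq i j k l : [set i; j; k]%SET \in T -> [set i; j; l]%SET \in T ->
  0 < o i j k -> 0 < o i j l -> k = l.
Proof.
move=> kT lT ok ol; apply/eqP/negPn/negP => kl.
have [ij jk ik] := orient_neq _ _ _ _ (lt0r_neq0 ok).
pose m := p i + 2^-1 *: (p j - p i).
have jlm : 0 < orient (p j) (p l) m.
  rewrite orient_line (_ : o j l j = 0); last by rewrite /orient; ring.
  by rewrite mulr0 addr0 -(orient_rot (p i)) mulr_gt0 // subr_gt0 invf_lt1 ?ltr1n.
have lim : 0 < orient (p l) (p i) m.
  rewrite orient_line (_ : o l i i = 0); last by rewrite /orient; ring.
  by rewrite mulr0 add0r (orient_rot (p l)) mulr_gt0 ?invr_gt0 ?ltr0n.
have ijm : orient (p i) (p j) m = 0 by rewrite orient_line /orient; ring.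
have N1 := near_line_gt0 _ (o j l k) jlm; have N2 := near_line_gt0 _ (o l i k) lim.
have : \forall d \near (0 : R)^'+, d < 1 by apply: nbhs_right_lt; rewrite ltr01.
move=> N3; have N4 := nbhs_right_gt (0 : R).
have [d [[h1 h2] [d1 d0]]] := filter_ex (filterI (filterI N1 N2) (filterI N3 N4)).
pose x := m + d *: (p k - m).
have ijx : orient (p i) (p j) x = d * o i j k by rewrite orient_line ijm mulr0 add0r.
have xk : hull p [set i; j; k]%SET x.
  apply: hull_line; first by rewrite !ltW.
    apply: hull_line; first by rewrite invr_ge0 ler0n invf_le1 ?ler1n.
      by apply: hull_vertex; rewrite !inE eqxx.
    by apply: hull_vertex; rewrite !inE eqxx !orbT.
  by apply: hull_vertex; rewrite !inE eqxx !orbT.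
have xl : hull p [set i; j; l]%SET x.
  apply/hull3_orient => //; split; rewrite ?ijx ?mulr_ge0 ?ltW //.
    by rewrite orient_line.
  by rewrite orient_line.
case: HT => _ HI _ _.
have := HI _ _ kT lT; move=> /(congr1 (@^~ x)) E.
have {E} h : hull p ([set i; j; k] :&: [set i; j; l])%SET x by rewrite -E.
have := hull_eq0 _ (aff_orient (p i) (p j)) _ h; rewrite aff_orientE ijx => H.
suff : d * o i j k = 0 by apply/eqP; rewrite gt_eqF ?mulr_gt0.
apply: H => v; rewrite !inE aff_orientE => /andP[/orP[/orP[]|] /eqP ->].
- by move=> _; rewrite /orient; ring.
- by move=> _; rewrite /orient; ring.
by rewrite (negPf kl) [k == i]eq_sym [k == j]eq_sym (negPf ik) (negPf jk).
Qed.

Lemma same_side_eq_neg i j k l :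
  [set i; j; k]%SET \in T -> [set i; j; l]%SET \in T ->
  o i j k < 0 -> o i j l < 0 -> k = l.
Proof.
rewrite -!(set3_swap i j) => kT lT k0 l0.
by apply: (same_side_eq _ _ _ _ kT lT); rewrite orient_swap oppr_gt0.
Qed.

Lemma opposite_sides i j k l : [set i; j; k]%SET \in T -> [set i; j; l]%SET \in T ->
  0 < o i j k -> k != l -> o i j l < 0.
Proof.
move=> kT lT ok kl; have := tri_orient _ _ _ lT; rewrite neq_lt => /orP[//|ol].
by rewrite (same_side_eq _ _ _ _ kT lT ok ol) eqxx in kl.
Qed.

(** Membership in a triangle amounts to three affine inequalities, and along a
    segment the truth value of each is constant near the starting point. *)
Lemma near_hull_tri t x y : t \in T ->
  (hull p t x /\ \forall d \near 0^'+, hull p t (x + d *: (y - x))) \/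
  (\forall d \near 0^'+, ~ hull p t (x + d *: (y - x))).
Proof.
move=> tT; have [i it] : exists i, i \in t.
  case: HT => H _ _ _; have [t3 _] := H _ tT.
  by apply/set0Pn; rewrite -card_gt0 t3.
have [j [k [-> o0]]] := tri_vertex _ _ tT it.
pose f a b := (fun d => 0 <= (1 - d) * orient a b x + d * orient a b y) : R -> Prop.
have E d : hull p [set i; j; k]%SET (x + d *: (y - x)) <->
    [/\ f (p i) (p j) d, f (p j) (p k) d & f (p k) (p i) d].
  by rewrite /f -!orient_line; apply: hull3_orient.
have D a b := near_line_ge0 (orient a b x) (orient a b y).
case: (D (p i) (p j)) => [h1|h1]; last first.
  by right; apply: filterS h1 => d h /E[].
case: (D (p j) (p k)) => [h2|h2]; last first.
  by right; apply: filterS h2 => d h /E[].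
case: (D (p k) (p i)) => [h3|h3]; last first.
  by right; apply: filterS h3 => d h /E[].
left; split.
  apply/hull3_orient => //; split.
  - exact: near_line_ge0_start h1.
  - exact: near_line_ge0_start h2.
  - exact: near_line_ge0_start h3.
by apply: filterS3 h1 h2 h3 => d g1 g2 g3; apply/E.
Qed.

(** A triangulation has only finitely many triangles, so the points of a segment
    near its start all lie in a single one of them. *)
Lemma germ_tri x y : hull p [set: 'I_n] x -> hull p [set: 'I_n] y ->
  exists2 t, t \in T & hull p t x /\ \forall d \near 0^'+, hull p t (x + d *: (y - x)).
Proof.
move=> hx hy; apply: contrapT => no.
have : forall t, \forall d \near (0 : R)^'+, t \in T -> ~ hull p t (x + d *: (y - x)).
  move=> t; have [tT|tT] := boolP (t \in T); last by apply: nearW.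
  case: (near_hull_tri t x y tT) => [h|h]; last by apply: filterS h => d h _.
  by exfalso; apply: no; exists t.
move=> /filter_forall N.
have : \forall d \near (0 : R)^'+, d < 1 by apply: nbhs_right_lt; rewrite ltr01.
move=> N1; have N0 := nbhs_right_gt (0 : R).
have [d [Nd [d1 d0]]] := filter_ex (filterI N (filterI N1 N0)).
have : hull p [set: 'I_n] (x + d *: (y - x)) by apply: hull_line; rewrite // !ltW.
case: HT => _ _ _ <- [t /= tT ht].
exact: Nd ht.
Qed.

End Structure.

Section Neighbors.
Context {R : realType} {n : nat}.
Variables (p : 'I_n -> plane R) (T : {set {set 'I_n}}).
Hypothesis HT : triangulation p T.
Implicit Types (t A : {set 'I_n}) (i j k l : 'I_n) (x y : plane R)
  (L : R * plane R).

Local Notation o i j k := (orient (p i) (p j) (p k)).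

Lemma mem_of_hullI t A x L : hull p (t :&: A)%SET x -> aval L x != 0 ->
  exists i, [/\ i \in t, i \in A & aval L (p i) != 0].
Proof.
move=> h Lx; apply: contrapT => no; case/negP: Lx; apply/eqP.
apply: (hull_eq0 _ _ _ _ h) => v; rewrite inE => /andP[vt vA].
by apply: contrapT => /eqP Lv; apply: no; exists v.
Qed.

(** Follow the segment from the midpoint [m] of the edge [i j] to a point of the
    hull beyond the edge: the triangle that contains its first points also
    contains [m], so it shares the face of [m], which is the whole edge. *)
Lemma neighbor_across i j k (e : R) : [set i; j; k]%SET \in T -> 0 < o i j k ->
  let m := p i + 2^-1 *: (p j - p i) in
  0 < e -> hull p [set: 'I_n] (m + e *: (m - p k)) ->
  exists l, [set i; j; l]%SET \in T /\ o i j l < 0.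
Proof.
move=> kT ok m e0 hy; have [ij jk ik] := orient_neq _ _ _ _ (lt0r_neq0 ok).
set y := m + _ in hy.
have inT v : v \in [set i; j; k]%SET -> hull p [set i; j; k]%SET (p v).
  exact: hull_vertex.
have hmk : hull p [set i; j; k]%SET m.
  apply: hull_line; first by rewrite invr_ge0 ler0n invf_le1 ?ler1n.
    by apply: inT; rewrite !inE eqxx.
  by apply: inT; rewrite !inE eqxx !orbT.
have hm : hull p [set: 'I_n] m by apply: hullS hmk; apply/fintype.subsetP.
have [t tT [tm ty]] := germ_tri _ _ HT _ _ hm hy.
have hI : hull p ([set i; j; k] :&: t)%SET m.
  by case: HT => _ /(_ _ _ kT tT) <-.
have zi (a b : plane R) : orient a b a = 0 by rewrite /orient; ring.
have zj (a b : plane R) : orient a b b = 0 by rewrite /orient; ring.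
have half0 : 0 < 2^-1 :> R by rewrite invr_gt0 ltr0n.
have it : i \in t.
  have : aval (aff_orient (p j) (p k)) m != 0.
    rewrite aff_orientE orient_line zi mulr0 addr0 -orient_rot mulf_neq0 ?gt_eqF //.
    by rewrite subr_gt0 invf_lt1 ?ltr1n.
  move=> /(mem_of_hullI _ _ _ _ hI)[v []]; rewrite !inE aff_orientE.
  by move=> /orP[/orP[]|] /eqP ->; rewrite ?zi ?zj ?eqxx.
have jt : j \in t.
  have : aval (aff_orient (p k) (p i)) m != 0.
    by rewrite aff_orientE orient_line zj mulr0 add0r orient_rot mulf_neq0 ?gt_eqF.
  move=> /(mem_of_hullI _ _ _ _ hI)[v []]; rewrite !inE aff_orientE.
  by move=> /orP[/orP[]|] /eqP ->; rewrite ?zi ?zj ?eqxx.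
have [l tE] := tri_edge _ _ HT _ _ _ tT it jt ij.
exists l; rewrite -tE; split=> //; rewrite ltNge; apply/negP => ol.
have [d [td d0]] := filter_ex (filterI ty (nbhs_right_gt 0)).
have := hull_ge0 _ _ (aff_orient (p i) (p j)) _ td.
rewrite aff_orientE.
have ijm : orient (p i) (p j) m = 0 by rewrite orient_line zi zj; ring.
have -> : orient (p i) (p j) (m + d *: (y - m)) = - (d * e * o i j k).
  rewrite orient_line ijm mulr0 add0r /y.
  have -> : m + e *: (m - p k) = p k + (1 + e) *: (m - p k).
    by rewrite scalerDl scale1r addrA [p k + _]addrC subrK.
  rewrite orient_line ijm; ring.
move=> H; have : 0 <= - (d * e * o i j k).
  apply: H => v; rewrite tE !inE aff_orientE.
  by move=> /orP[/orP[]|] /eqP ->; rewrite ?zi ?zj.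
by rewrite oppr_ge0 leNgt !mulr_gt0.
Qed.

(** If [p v] is interior, it can be moved a little in the direction [m - p k]; half
    that displacement, at the midpoint [m], stays in the hull by convexity. *)
Lemma interior_neighbor i j k v : [set i; j; k]%SET \in T -> 0 < o i j k ->
  (v == i) || (v == j) -> (hull p [set: 'I_n])° (p v) ->
  exists l, [set i; j; l]%SET \in T /\ o i j l < 0.
Proof.
move=> kT ok vij vint; set m := p i + 2^-1 *: (p j - p i).
have := near_interior _ _ (m - p k) vint => N.
have [e [he e0]] := filter_ex (filterI N (nbhs_right_gt 0)).
pose w := if v == i then j else i.
have hw : hull p [set: 'I_n] (p w) by apply: hull_vertex; rewrite inE.
apply: (neighbor_across i j k (2^-1 * e)) => //; first by rewrite mulr_gt0 ?invr_gt0 ?ltr0n.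
rewrite -/m.
have -> : m + (2^-1 * e) *: (m - p k)
    = (p v + e *: (m - p k)) + 2^-1 *: (p w - (p v + e *: (m - p k))).
  apply: plane_eq => L; rewrite aval_line.
  have -> : m + (2^-1 * e) *: (m - p k) = p k + (1 + 2^-1 * e) *: (m - p k).
    by rewrite scalerDl scale1r addrA [p k + _]addrC subrK.
  have -> : aval L (p v + e *: (m - p k)) = aval L (p v) + e * (aval L m - aval L (p k)).
    by rewrite /aval /dot /= /GRing.scale /=; ring.
  rewrite !aval_line /w; case/orP: vij => /eqP ->; rewrite ?eqxx; first by field.
  by case: eqP => [->|_]; field.
apply: hull_line => //; first by rewrite invr_ge0 ler0n invf_le1 ?ler1n.
Qed.

Lemma lone_edge_boundary i j k : [set i; j; k]%SET \in T ->
  (forall l, [set i; j; l]%SET \in T -> l = k) ->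
  boundary (hull p [set: 'I_n]) (p i).
Proof.
move=> kT one; split.
  by apply: subset_closure; apply: hull_vertex; rewrite inE.
move=> iint; have := tri_orient _ _ HT _ _ _ kT; rewrite neq_lt => /orP[neg|pos].
  have pos' : 0 < o j i k by rewrite orient_swap oppr_gt0.
  have kT' : [set j; i; k]%SET \in T by rewrite set3_swap.
  have ij : (i == j) || (i == i) by rewrite eqxx orbT.
  have [l [lT lneg]] := interior_neighbor j i k i kT' pos' ij iint.
  rewrite set3_swap in lT; move: lneg.
  by rewrite (one _ lT) ltNge ltW.
have ij : (i == i) || (i == j) by rewrite eqxx.
have [l [lT lneg]] := interior_neighbor i j k i kT pos ij iint.
by move: lneg; rewrite (one _ lT) ltNge ltW.
Qed.

End Neighbors.

(** * The energy as a sum over edges and over triangles *)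

Section TripleSums.
Context {R : realType} {n : nat}.
Implicit Types (F : 'I_n -> 'I_n -> 'I_n -> R) (t : {set 'I_n})
  (T : {set {set 'I_n}}) (i j k : 'I_n).

(** Sums over a triangle are taken over the orderings of its vertices: each
    triangle contributes six terms ([triple_sum3]). *)
Definition triple_sum F t : R :=
  \sum_i \sum_j \sum_(k | [set i; j; k]%SET == t) F i j k.

Lemma triple_sum_all F T :
  \sum_i \sum_j \sum_(k | [set i; j; k]%SET \in T) F i j k
  = \sum_(t in T) triple_sum F t.
Proof.
rewrite [RHS]exchange_big; apply: eq_bigr => i _.
rewrite [RHS]exchange_big; apply: eq_bigr => j _.
rewrite (partition_big (fun k => [set i; j; k]%SET) (mem T)) //=.
apply: eq_bigr => t tT; apply: eq_bigl => k.
by case: eqP => [->|]; rewrite ?tT ?andbF.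
Qed.

Lemma set3_eq i j k v : i != j -> j != k -> i != k ->
  ([set i; j; v]%SET == [set i; j; k]%SET) = (v == k).
Proof.
move=> ij jk ik; apply/eqP/eqP => [E|->//].
have := congr1 (fun A : {set 'I_n} => k \in A) E; rewrite !inE eqxx orbT [k == i]eq_sym [k == j]eq_sym.
by rewrite (negPf ik) (negPf jk) => /eqP.
Qed.

Lemma sum2 (f : 'I_n -> R) i j : i != j ->
  (forall v, v != i -> v != j -> f v = 0) -> \sum_v f v = f i + f j.
Proof.
move=> ij f0; rewrite (bigD1 i) //= (bigD1 j) /=; last by rewrite eq_sym.
by rewrite big1 ?addr0 // => v /andP[vi vj]; apply: f0.
Qed.

Lemma sum3 (f : 'I_n -> R) i j k : i != j -> j != k -> i != k ->
  (forall v, v != i -> v != j -> v != k -> f v = 0) ->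
  \sum_v f v = f i + f j + f k.
Proof.
move=> ij jk ik f0; rewrite (bigD1 i) //= (bigD1 j) /=; last by rewrite eq_sym.
rewrite (bigD1 k) /=; last by rewrite ![k == _]eq_sym ik jk.
rewrite big1 ?addr0 ?addrA // => v /andP[/andP[vi vj] vk]; exact: f0.
Qed.

Lemma triple_sum3 F i j k : i != j -> j != k -> i != k ->
  triple_sum F [set i; j; k]%SET
  = (F i j k + F i k j) + (F j i k + F j k i) + (F k i j + F k j i).
Proof.
have half a b c : a != b -> b != c -> a != c ->
    \sum_x \sum_(y | [set a; x; y]%SET == [set a; b; c]%SET) F a x y
    = F a b c + F a c b.
  move=> ab bc ac; rewrite (sum2 _ b c) //.
    congr (_ + _); apply: big_pred1 => y; first exact: set3_eq.
    have -> : [set a; b; c]%SET = [set a; c; b]%SET by rewrite finset.setUAC.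
    by apply: set3_eq; rewrite // eq_sym.
  move=> x xb xc; rewrite big_pred0 // => y; apply/eqP => E.
  have xa : x = a.
    have := congr1 (fun A : {set 'I_n} => x \in A) E; rewrite !inE eqxx orbT (negPf xb) (negPf xc) !orbF /=.
    by move=> /esym /eqP.
  have := congr1 (fun A : {set 'I_n} => b \in A) E.
  have := congr1 (fun A : {set 'I_n} => c \in A) E.
  rewrite xa !inE !eqxx !orbT [c == a]eq_sym [b == a]eq_sym (negPf ab) (negPf ac) /=.
  by move=> /eqP cy /eqP by_; rewrite by_ cy eqxx in bc.
move=> ij jk ik; rewrite /triple_sum (sum3 _ i j k) //; last first.
  move=> v vi vj vk; rewrite big1 // => x _; rewrite big_pred0 // => y.
  apply/eqP => /(congr1 (fun A : {set 'I_n} => v \in A)).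
  by rewrite !inE eqxx (negPf vi) (negPf vj) (negPf vk).
rewrite half //; congr (_ + _ + _).
  by rewrite -set3_swap half // eq_sym.
have -> : [set i; j; k]%SET = [set k; i; j]%SET by rewrite [RHS]set3_rot.
by rewrite half // eq_sym.
Qed.

End TripleSums.

Section Energy.
Context {R : realType} {n : nat}.
Variables (p : 'I_n -> plane R) (s u : 'I_n -> R).
Hypothesis u_bd : forall i, boundary (hull p [set: 'I_n]) (p i) -> u i = 0.
Implicit Types (T : {set {set 'I_n}}) (t : {set 'I_n}) (i j k l : 'I_n).

Local Notation o i j k := (orient (p i) (p j) (p k)).

(** An edge that lies in only one triangle has both ends on the boundary of the
    hull, where [u] vanishes. *)
Lemma edge_two_triangles T i j k0 : triangulation p T -> u i != u j ->
  [set i; j; k0]%SET \in T ->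
  exists k l, [/\ 0 < o i j k, o i j l < 0
    & forall v, ([set i; j; v]%SET \in T) = (v == k) || (v == l)].
Proof.
move=> HT uij kT.
have [k1 k1T k10] : exists2 k1, [set i; j; k1]%SET \in T & k1 != k0.
  apply: contrapT => no; case/eqP: uij.
  have one v : [set i; j; v]%SET \in T -> v = k0.
    by move=> vT; apply/eqP/negPn/negP => v0; apply: no; exists v.
  have kT' : [set j; i; k0]%SET \in T by rewrite set3_swap.
  have one' v : [set j; i; v]%SET \in T -> v = k0.
    by rewrite set3_swap; exact: one.
  rewrite (u_bd i (lone_edge_boundary _ _ HT i j k0 kT one)).
  by rewrite (u_bd j (lone_edge_boundary _ _ HT j i k0 kT' one')).
have [k [l [kT' lT ok ol]]] : exists k l, [/\ [set i; j; k]%SET \in T,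
    [set i; j; l]%SET \in T, 0 < o i j k & o i j l < 0].
  have [neg|pos] : o i j k0 < 0 \/ 0 < o i j k0.
      by apply/orP; rewrite -neq_lt; apply: tri_orient kT.
    have [neg1|pos1] : o i j k1 < 0 \/ 0 < o i j k1.
        by apply/orP; rewrite -neq_lt; apply: tri_orient k1T.
      by case/eqP: k10; apply: same_side_eq_neg HT _ _ _ _ k1T kT neg1 neg.
    by exists k1, k0; split.
  exists k0, k1; split=> //.
  by apply: (opposite_sides _ _ HT _ _ _ _ kT k1T pos); rewrite eq_sym.
exists k, l; split=> // v; apply/idP/idP => [vT|/orP[]/eqP -> //].
have [neg|pos] : o i j v < 0 \/ 0 < o i j v.
    by apply/orP; rewrite -neq_lt; apply: tri_orient vT.
  by apply/orP; right; apply/eqP; apply: same_side_eq_neg HT _ _ _ _ vT lT neg ol.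
by apply/orP; left; apply/eqP; apply: (same_side_eq _ _ HT i j _ _ vT kT' pos ok).
Qed.

(** For an edge that lies in two triangles this is its hinge weight. *)
Definition edge_weight T i j : R :=
  \sum_(k | [set i; j; k]%SET \in T) half_hinge p s i j k.

Lemma edge_weight2 T i j k l : 0 < o i j k -> o i j l < 0 ->
  (forall v, ([set i; j; v]%SET \in T) = (v == k) || (v == l)) ->
  edge_weight T i j = half_hinge p s i j k + half_hinge p s i j l.
Proof.
move=> ok ol E; rewrite /edge_weight (eq_bigl _ _ E).
have kl : k != l by apply: contraTneq ok => ->; rewrite ltNge ltW.
rewrite (bigD1 k) ?eqxx //= (big_pred1 l) // => v /=.
by case: eqP => [->|//] /=; rewrite ?andbF ?(negPf kl) ?andbT.
Qed.

Lemma energy_edges T : triangulation p T ->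
  dirichlet_energy p s T u =
  2^-1 * \sum_(i < n) \sum_(j < n | (i < j)%N) edge_weight T i j * (u i - u j) ^+ 2.
Proof.
move=> HT; congr (_ * _); apply: eq_bigr => i _; apply: eq_bigr => j _.
have [->|uij] := eqVneq (u i) (u j).
  rewrite subrr expr0n mulr0 big1 // => k _; rewrite big1 // => l _.
  by rewrite mulr0.
have [[k0 kT]|no] := pselect (exists k, [set i; j; k]%SET \in T); last first.
  rewrite /edge_weight [in RHS]big_pred0 ?mul0r; last first.
    by move=> k; apply/negP => kT; apply: no; exists k.
  rewrite big1 // => k _; rewrite big_pred0 // => l.
  by apply/negP => /and3P[_ kT _]; apply: no; exists k.
have [k [l [ok ol E]]] := edge_two_triangles T i j k0 HT uij kT.
have kl : k != l by apply: contraTneq ok => ->; rewrite ltNge ltW.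
have pair (a b : 'I_n) : (a < b)%N ->
    (forall v, ([set i; j; v]%SET \in T) = (v == a) || (v == b)) ->
    \sum_(k < n) \sum_(l < n | [&& (k < l)%N, [set i; j; k]%SET \in T & [set i; j; l]%SET \in T])
      hinge p s i j k l * (u i - u j) ^+ 2
    = hinge p s i j a b * (u i - u j) ^+ 2.
  move=> ab Eab; rewrite pair_big_dep /=.
  rewrite (big_pred1 (a, b)) // => -[x y] /=; rewrite !Eab xpair_eqE.
  apply/and3P/andP => [[xy /orP[]/eqP ex /orP[]/eqP ey]|[/eqP -> /eqP ->]];
    subst; rewrite ?eqxx ?orbT //.
  - by rewrite ltnn in xy.
  - by move: ab; rewrite ltnNge ltnW.
  - by rewrite ltnn in xy.
have ok' := lt0r_neq0 ok; have ol' := ltr0_neq0 ol.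
rewrite (edge_weight2 T i j k l) //.
move: (kl); rewrite -(inj_eq val_inj) /= neq_ltn => /orP[klt|lkt].
  by rewrite (pair k l) // hingeE.
by rewrite (pair l k) // ?hingeE // 1?addrC // => v; rewrite E orbC.
Qed.

Lemma edge_weightC T i j : edge_weight T i j = edge_weight T j i.
Proof.
by apply: eq_big => [k|k _]; [rewrite set3_swap | rewrite half_hingeC].
Qed.

(** Every side of the triangle occurs in both directions, whence the factor. *)
Definition tri_energy t : R :=
  2^-1 * triple_sum (fun i j k => half_hinge p s i j k * (u i - u j) ^+ 2) t.

Lemma tri_energyE i j k : i != j -> j != k -> i != k ->
  tri_energy [set i; j; k]%SET = triangle_energy p s u i j k.
Proof.
move=> ij jk ik; rewrite /tri_energy triple_sum3 // /triangle_energy.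
rewrite (half_hingeC p s j i) (half_hingeC p s i k) (half_hingeC p s k j).
by field.
Qed.

Lemma energy_triangles T : triangulation p T ->
  dirichlet_energy p s T u = 2^-1 * \sum_(t in T) tri_energy t.
Proof.
move=> HT; rewrite energy_edges // /tri_energy -mulr_sumr -triple_sum_all.
congr (_ * _).
under [in RHS]eq_bigr do under eq_bigr do rewrite -mulr_suml -/(edge_weight _ _ _).
set f := fun i j => edge_weight T i j * (u i - u j) ^+ 2.
have fC i j : f i j = f j i by rewrite /f edge_weightC -sqrrN opprB.
have fii i : f i i = 0 by rewrite /f subrr expr0n mulr0.
have lt_gt : \sum_(i < n) \sum_(j < n | (j < i)%N) f i j
    = \sum_(i < n) \sum_(j < n | (i < j)%N) f i j.
  rewrite (exchange_big_dep xpredT) //=; apply: eq_bigr => i _.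
  by apply: eq_bigr => j _; apply: fC.
have -> : \sum_i \sum_j f i j = 2 * \sum_(i < n) \sum_(j < n | (i < j)%N) f i j.
  rewrite mulr2n mulrDl mul1r -[X in X + _]lt_gt -big_split /=.
  apply: eq_bigr => i _; rewrite (bigID (fun j : 'I_n => (j < i)%N)) /=; congr (_ + _).
  rewrite (bigD1 i) /= ?ltnn // fii add0r; apply: eq_bigl => j.
  by rewrite -leqNgt ltn_neqAle andbC eq_sym.
by rewrite mulrA mulVf ?mul1r // pnatr_eq0.
Qed.

End Energy.

(** * Triangulations that carry the convex envelope *)

Section Supported.
Context {R : realType} {n : nat}.
Variables (p : 'I_n -> plane R) (s : 'I_n -> R).
Implicit Types (T : {set {set 'I_n}}) (t : {set 'I_n}) (i j k l v : 'I_n)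
  (L D : R * plane R) (x : plane R).

Local Notation o i j k := (orient (p i) (p j) (p k)).

Lemma avalB L D x : aval (L - D) x = aval L x - aval D x.
Proof. rewrite /aval /dot /=; ring. Qed.

Lemma aval_barycentric L i j k x :
  aval L x * o i j k = aval L (p i) * orient (p j) (p k) x
    + aval L (p j) * orient (p k) (p i) x + aval L (p k) * orient (p i) (p j) x.
Proof. rewrite /aval /orient /dot /=; ring. Qed.

Lemma aval_edge L i j k x : aval L (p i) = 0 -> aval L (p j) = 0 ->
  aval L x * o i j k = aval L (p k) * orient (p i) (p j) x.
Proof. by move=> Li Lj; rewrite aval_barycentric Li Lj !mul0r !add0r. Qed.

Definition supports L t : Prop :=
  (forall i, aval L (p i) <= s i) /\ (forall i, i \in t -> aval L (p i) = s i).

(** The interpolant on [T] is the convex envelope of the values [s]. *)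
Definition supported T : Prop := forall t, t \in T -> exists L, supports L t.

(** Both supporting functions agree with [s] at [i] and [j]; each lies below the
    other at one of two points on the same side of the line [i j], so they
    coincide. *)
Lemma supports_half_hinge L D i j k l : 0 < o i j k -> 0 < o i j l ->
  supports L [set i; j; k]%SET -> supports D [set i; j; l]%SET ->
  half_hinge p s i j k = half_hinge p s i j l.
Proof.
move=> ok ol [Ls Le] [Ds De]; apply/eqP; rewrite -subr_eq0 half_hinge_same //.
suff -> : lift_det p s i j k l = 0 by rewrite mul0r.
have Li := Le i; have Lj := Le j; have Lk := Le k; move: Li Lj Lk.
have Di := De i; have Dj := De j; have Dl := De l; move: Di Dj Dl.
rewrite !inE !eqxx !orbT => /(_ isT) Di /(_ isT) Dj /(_ isT) Dl.
move=> /(_ isT) Li /(_ isT) Lj /(_ isT) Lk.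
apply/eqP; rewrite eq_le; apply/andP; split.
  rewrite (lift_det_touch _ L) /lift_det Li Lj Lk !subrr !mul0r subrr !add0r.
  by rewrite oppr_le0; apply: mulr_ge0; [rewrite subr_ge0 | exact: ltW].
rewrite (lift_det_touch _ D) /lift_det Di Dj Dl !subrr !mul0r subrr add0r subr0.
by apply: mulr_ge0; [rewrite subr_ge0 | exact: ltW].
Qed.

(** The edges [i j] of [T] and [i v] of [T'] have the same direction at [i]. The
    shorter one ends inside the other, and as a vertex it must be an end of it. *)
Lemma vertex_on_edge T T' t i j k v (b d : R) :
  triangulation p T -> triangulation p T' ->
  [set i; j; k]%SET \in T -> t \in T' -> i \in t -> v \in t -> v != i ->
  0 < b -> 0 < d -> o i j v = 0 ->
  p i + b *: (p v - p i) = p i + d *: (p j - p i) -> j \in t.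
Proof.
move=> HT HT' kT tT' it vt vi b0 d0 oijv E.
have EL L : (1 - b) * aval L (p i) + b * aval L (p v)
    = (1 - d) * aval L (p i) + d * aval L (p j).
  by rewrite -!aval_line E.
have [bd|db] := leP d b.
  have pv : p v = p i + (d / b) *: (p j - p i).
    apply: plane_eq => L; rewrite aval_line.
    have b0' := lt0r_neq0 b0; apply: (mulfI b0').
    transitivity ((1 - b) * aval L (p i) + b * aval L (p v) - (1 - b) * aval L (p i)).
      by ring.
    by rewrite EL; field.
  have : v \in [set i; j; k]%SET.
    apply: (hull_tri_vertex _ _ HT) => //; rewrite pv; apply: hull_line.
    - by apply/andP; split; [rewrite divr_ge0 ?ltW | rewrite ler_pdivrMr // mul1r].
    - by apply: hull_vertex; rewrite !inE eqxx.
    - by apply: hull_vertex; rewrite !inE eqxx orbT.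
  rewrite !inE (negPf vi) /= => /orP[/eqP <- //|/eqP vk].
  by move: (tri_orient _ _ HT _ _ _ kT); rewrite -vk oijv eqxx.
have pj : p j = p i + (b / d) *: (p v - p i).
  apply: plane_eq => L; rewrite aval_line.
  have d0' := lt0r_neq0 d0; apply: (mulfI d0').
  transitivity ((1 - d) * aval L (p i) + d * aval L (p j) - (1 - d) * aval L (p i)).
    by ring.
  by rewrite -EL; field.
apply: (hull_tri_vertex _ _ HT') => //; rewrite pj; apply: hull_line.
- by apply/andP; split; [rewrite divr_ge0 ?ltW | rewrite ler_pdivrMr // mul1r ltW].
- exact: hull_vertex.
- exact: hull_vertex.
Qed.

(** A nonzero [lift_det] says that the convex envelope has a genuine crease along
    [i j]. It is affine on each triangle of [T'], so none of them crosses the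
    crease; the one that the crease enters at [i] has it as a side. *)
Lemma crease_edge T T' i j k l : triangulation p T -> triangulation p T' ->
  supported T -> supported T' ->
  [set i; j; k]%SET \in T -> [set i; j; l]%SET \in T ->
  0 < o i j k -> lift_det p s i j k l != 0 ->
  exists2 t, t \in T' & (i \in t) && (j \in t).
Proof.
move=> HT HT' ST ST' kT lT ok crease.
have [ij jk ik] := orient_neq _ _ _ _ (lt0r_neq0 ok).
have [L [Ls Le]] := ST _ kT; have [M [Ms Me]] := ST _ lT.
have Li : aval L (p i) = s i by apply: Le; rewrite !inE eqxx.
have Lj : aval L (p j) = s j by apply: Le; rewrite !inE eqxx orbT.
have Lk : aval L (p k) = s k by apply: Le; rewrite !inE eqxx orbT.
have Mi : aval M (p i) = s i by apply: Me; rewrite !inE eqxx.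
have Mj : aval M (p j) = s j by apply: Me; rewrite !inE eqxx orbT.
have Ml : aval M (p l) = s l by apply: Me; rewrite !inE eqxx orbT.
have Ll : s l - aval L (p l) != 0.
  apply: contra_neq crease => E.
  by rewrite (lift_det_touch _ L) /lift_det Li Lj Lk E !subrr !mul0r; ring.
(* The two supporting functions differ by a nonzero multiple of
   [orient (p i) (p j)], so they agree on the line [i j] only. *)
have on_line v : aval L (p v) = s v -> aval M (p v) = s v -> o i j v = 0.
  move=> Lv Mv; have := aval_edge (M - L) i j l (p v).
  rewrite !avalB Li Lj Mi Mj Lv Mv Ml !subrr mul0r => /(_ erefl erefl) /esym /eqP.
  by rewrite mulf_eq0 (negPf Ll) => /eqP.
have hi : hull p [set: 'I_n] (p i) by apply: hull_vertex; rewrite inE.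
have hj : hull p [set: 'I_n] (p j) by apply: hull_vertex; rewrite inE.
have [t tT' [ti near_t]] := germ_tri _ _ HT' _ _ hi hj.
have it : i \in t by apply: (hull_tri_vertex _ _ HT').
exists t => //; rewrite it /=.
have [d [xt d0]] := filter_ex (filterI near_t (nbhs_right_gt 0)).
have [v [w [tE ot]]] := tri_vertex _ _ HT' _ _ tT' it.
have [iv vw iw] := orient_neq _ _ _ _ (lt0r_neq0 ot).
have vt : v \in t by rewrite tE !inE eqxx orbT.
have wt : w \in t by rewrite tE !inE eqxx !orbT.
rewrite tE in xt; have [a [b [c [a0 b0 c0 abc E]]]] := hull3_aval _ _ _ _ _ iv vw iw xt.
have [N [Ns Ne]] := ST' _ tT'.
have Ni := Ne _ it; have Nv := Ne _ vt; have Nw := Ne _ wt.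
(* At the point at distance [d] along the edge, [Z] is at least the supporting
   function of [t], and it is at most so at the vertices of [t]: it equals [s] at
   the vertices that carry weight. *)
have flat Z : (forall v, aval Z (p v) <= s v) -> aval Z (p i) = s i ->
    aval Z (p j) = s j ->
    b * (s v - aval Z (p v)) = 0 /\ c * (s w - aval Z (p w)) = 0.
  move=> Zs Zi Zj.
  have bv : 0 <= b * (s v - aval Z (p v)) by rewrite mulr_ge0 ?subr_ge0.
  have cw : 0 <= c * (s w - aval Z (p w)) by rewrite mulr_ge0 ?subr_ge0.
  have := E Z; have := E N; rewrite !aval_line Ni Nv Nw Zi Zj => EN EZ.
  have Nj : d * aval N (p j) <= d * s j by apply: ler_wpM2l; rewrite // ltW.
  by split; apply/eqP; rewrite eq_le; apply/andP; split=> //; lra.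
have [bL cL] := flat L Ls Li Lj; have [bM cM] := flat M Ms Mi Mj.
have zero (e f : R) : 0 < e -> e * f = 0 -> f = 0.
  by move=> e0 /eqP; rewrite mulf_eq0 gt_eqF //= => /eqP.
have vline : 0 < b -> o i j v = 0.
  by move=> bp; apply: on_line; apply/esym/eqP; rewrite -subr_eq0; apply/eqP; exact: zero bp _.
have wline : 0 < c -> o i j w = 0.
  by move=> cp; apply: on_line; apply/esym/eqP; rewrite -subr_eq0; apply/eqP; exact: zero cp _.
have notboth : 0 < b -> 0 < c -> False.
  move=> bp cp; have := aval_edge (aff_orient (p i) (p v)) i j k (p w).
  rewrite !aff_orientE (wline cp) mulr0 (_ : o i v j = - o i j v); last first.
    by rewrite orient_swap_last.
  rewrite (vline bp) oppr0 (_ : o i v i = 0); last by rewrite /orient; ring.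
  move=> /(_ erefl erefl) /eqP; rewrite mulf_eq0 !gt_eqF //.
have [bp|bz] := ltP 0 b.
  have [cp|cz] := ltP 0 c; first by case: (notboth bp cp).
  have {}cz : c = 0 by apply: le_anti; rewrite cz.
  apply: (vertex_on_edge T T' t i j k v b d) => //; rewrite 1?eq_sym ?vline //.
  apply: plane_eq => Z; rewrite [RHS]E aval_line cz.
  by rewrite (_ : 1 - b = a) ?mul0r ?addr0 // -abc cz; ring.
have {}bz : b = 0 by apply: le_anti; rewrite bz.
have [cp|cz] := ltP 0 c; last first.
  have {}cz : c = 0 by apply: le_anti; rewrite cz.
  have := E (aff_orient (p k) (p i)); rewrite bz cz !mul0r !addr0.
  rewrite aval_line !aff_orientE (_ : o k i i = 0) ?mulr0 ?add0r; last first.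
    by rewrite /orient; ring.
  by rewrite orient_rot => /eqP; rewrite mulf_eq0 !gt_eqF.
apply: (vertex_on_edge T T' t i j k w c d) => //; rewrite 1?eq_sym ?wline //.
apply: plane_eq => Z; rewrite [RHS]E aval_line bz.
by rewrite (_ : 1 - c = a) ?mul0r ?addr0 // -abc bz; ring.
Qed.

Variable u : 'I_n -> R.
Hypothesis u_bd : forall i, boundary (hull p [set: 'I_n]) (p i) -> u i = 0.

(** A nonzero weight means a crease, so [i j] is an edge of both triangulations;
    the weights agree side by side. *)
Lemma supported_edge_weight T T' i j : triangulation p T -> triangulation p T' ->
  supported T -> supported T' -> u i != u j -> edge_weight p s T i j != 0 ->
  edge_weight p s T' i j = edge_weight p s T i j.
Proof.
move=> HT HT' ST ST' uij W0.
have [k0 k0T] : exists k, [set i; j; k]%SET \in T.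
  apply: contrapT => no; case/eqP: W0; rewrite /edge_weight big1 // => k kT.
  by exfalso; apply: no; exists k.
have [k [l [ok ol E]]] := edge_two_triangles _ _ u_bd T i j k0 HT uij k0T.
have kT : [set i; j; k]%SET \in T by rewrite E eqxx.
have lT : [set i; j; l]%SET \in T by rewrite E eqxx orbT.
have WE := edge_weight2 _ s T i j k l ok ol E.
have crease : lift_det p s i j k l != 0.
  by apply: contraNneq W0 => e; rewrite WE half_hinge_opp // e mul0r.
have [t tT' /andP[it jt]] := crease_edge T T' i j k l HT HT' ST ST' kT lT ok crease.
have [ij _ _] := orient_neq _ _ _ _ (lt0r_neq0 ok).
have [k1 tE] := tri_edge _ _ HT' _ _ _ tT' it jt ij; rewrite tE in tT'.
have [k' [l' [ok' ol' E']]] := edge_two_triangles _ _ u_bd T' i j k1 HT' uij tT'.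
have kT' : [set i; j; k']%SET \in T' by rewrite E' eqxx.
have lT' : [set i; j; l']%SET \in T' by rewrite E' eqxx orbT.
rewrite WE (edge_weight2 _ s T' i j k' l' ok' ol' E').
have [L HL] := ST _ kT; have [M HM] := ST _ lT.
have [L' HL'] := ST' _ kT'; have [M' HM'] := ST' _ lT'.
congr (_ + _); first exact: supports_half_hinge HL' HL.
rewrite -set3_swap in HM; rewrite -set3_swap in HM'.
rewrite ![half_hinge p s i j _]half_hingeC.
by apply: supports_half_hinge HM' HM; rewrite orient_swap oppr_gt0.
Qed.

Lemma supported_energy T T' : triangulation p T -> triangulation p T' ->
  supported T -> supported T' -> dirichlet_energy p s T u = dirichlet_energy p s T' u.
Proof.
move=> HT HT' ST ST'; rewrite !energy_edges //; congr (_ * _).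
apply: eq_bigr => i _; apply: eq_bigr => j _.
have [->|uij] := eqVneq (u i) (u j); first by rewrite subrr expr0n !mulr0.
congr (_ * _).
have [W0|W0] := eqVneq (edge_weight p s T i j) 0; last first.
  by rewrite (supported_edge_weight T T').
have [W0'|W0'] := eqVneq (edge_weight p s T' i j) 0; first by rewrite W0 W0'.
by rewrite (supported_edge_weight T' T).
Qed.

End Supported.

(** * Flips *)

Section Quadrilateral.
Context {R : realType} {n : nat}.
Variable p : 'I_n -> plane R.
Implicit Types (A : {set 'I_n}) (i j k l v : 'I_n) (L : R * plane R) (x : plane R).

Local Notation o i j k := (orient (p i) (p j) (p k)).

(** A point where [L] attains its maximum over the hull is a convex combination of
    the vertices that attain it. *)
Lemma hull_face A L x : hull p A x -> (forall v, v \in A -> aval L (p v) <= 0) ->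
  0 <= aval L x -> hull p [set v in A | aval L (p v) == 0]%SET x.
Proof.
move=> [w [w0 wA w1 xE]] L0; rewrite xE aval_sum // => Lx.
have wL v : w v * - aval L (p v) = 0.
  have nn a : true -> 0 <= w a * - aval L (p a).
    move=> _; have [aA|aA] := boolP (a \in A); last by rewrite (wA _ aA) mul0r.
    by rewrite mulr_ge0 // oppr_ge0 L0.
  apply: (psumr_eq0P nn) => //; apply/eqP; rewrite eq_le; apply/andP; split.
    rewrite -oppr_ge0 -sumrN; under eq_bigr do rewrite mulrN opprK.
    exact: Lx.
  exact: sumr_ge0.
exists w; split=> // v; rewrite inE negb_and => /orP[/wA //|Lv].
move/eqP: (wL v); rewrite mulf_eq0 => /orP[/eqP //|].
by rewrite oppr_eq0 (negPf Lv).
Qed.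

(** The quadrilateral with counterclockwise vertices [i], [l], [j], [k] is strictly
    convex: both diagonals [i j] and [k l] cut it into two positively oriented
    triangles. *)
Definition convex_quad i j k l : Prop :=
  [/\ 0 < o i j k, 0 < o j i l, 0 < o i l k & 0 < o j k l].

Lemma convex_quad_sym i j k l : convex_quad i j k l -> convex_quad j i l k.
Proof. by case. Qed.

Lemma convex_quad_diag i j k l : convex_quad i j k l -> convex_quad k l j i.
Proof.
move=> [A0 B0 C0 D0]; split.
- by rewrite (orient_rot (p k)) (orient_rot (p l)).
- by rewrite (orient_rot (p l)) (orient_rot (p k)).
- by rewrite (orient_rot (p k)).
- by rewrite (orient_rot (p l)).
Qed.

(** The diagonal [i j] decides in which of the two triangles the point lies. *)
Lemma quad_cover i j k l x : convex_quad i j k l -> hull p [set i; l; k]%SET x ->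
  hull p [set i; j; k]%SET x \/ hull p [set i; j; l]%SET x.
Proof.
move=> [A0 B0 C0 D0] hx.
have zi (a b : plane R) : orient a b a = 0 by rewrite /orient; ring.
have zj (a b : plane R) : orient a b b = 0 by rewrite /orient; ring.
have [il lk ki] := (hull3_orient _ _ _ _ _ C0).1 hx.
have jk : 0 <= orient (p j) (p k) x.
  rewrite -aff_orientE; apply: (hull_ge0 _ _ _ _ hx) => v.
  rewrite !inE aff_orientE => /orP[/orP[]|] /eqP ->.
  - by rewrite -orient_rot ltW.
  - exact: ltW.
  - by rewrite zj.
have lj : 0 <= orient (p l) (p j) x.
  rewrite -aff_orientE; apply: (hull_ge0 _ _ _ _ hx) => v.
  rewrite !inE aff_orientE => /orP[/orP[]|] /eqP ->.
  - by rewrite orient_rot ltW.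
  - by rewrite zi.
  - by rewrite orient_rot ltW.
have [ij|ij] := leP 0 (orient (p i) (p j) x).
  by left; apply/hull3_orient.
right; rewrite -set3_swap; apply/hull3_orient => //; split=> //.
by rewrite orient_swap oppr_ge0 ltW.
Qed.

End Quadrilateral.

Section Flip.
Context {R : realType} {n : nat}.
Variables (p : 'I_n -> plane R) (T : {set {set 'I_n}}).
Hypothesis HT : triangulation p T.
Implicit Types (t : {set 'I_n}) (i j k l v : 'I_n) (x : plane R).

Local Notation o i j k := (orient (p i) (p j) (p k)).

Definition flip i j k l : {set {set 'I_n}} :=
  ([set [set i; l; k]; [set j; k; l]] :|:
   T :\: [set [set i; j; k]; [set i; j; l]])%SET.

Lemma flipP i j k l t : t \in flip i j k l ->
  [\/ t = [set i; l; k]%SET, t = [set j; k; l]%SET |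
      [/\ t \in T, t != [set i; j; k]%SET & t != [set i; j; l]%SET]].
Proof.
rewrite !inE => /orP[/orP[]/eqP ->|]; [by constructor 1|by constructor 2|].
by rewrite negb_or => /andP[/andP[? ?] ?]; constructor 3.
Qed.

(** A triangle of [T] other than the two removed ones meets a new triangle in a
    common face: it meets the removed triangles so, and it cannot reach across
    the line [k l] to the other new triangle. *)
Lemma flip_meet i j k l t x : convex_quad p i j k l ->
  [set i; j; k]%SET \in T -> [set i; j; l]%SET \in T ->
  t \in T -> t != [set i; j; k]%SET -> t != [set i; j; l]%SET ->
  hull p [set i; l; k]%SET x -> hull p t x ->
  hull p ([set i; l; k] :&: t)%SET x.
Proof.
move=> Q kT lT tT tk tl hx ht; have [A0 B0 C0 D0] := Q.
have [ij _ _] := orient_neq _ _ _ _ (lt0r_neq0 A0).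
have not_both : ~ (i \in t /\ j \in t).
  move=> [it jt]; have [v tE] := tri_edge _ _ HT _ _ _ tT it jt ij.
  have vT : [set i; j; v]%SET \in T by rewrite -tE.
  have [neg|pos] : o i j v < 0 \/ 0 < o i j v.
      by apply/orP; rewrite -neq_lt; apply: tri_orient vT.
    have l0 : o i j l < 0 by rewrite orient_swap oppr_lt0.
    have vl := same_side_eq_neg _ _ HT _ _ _ _ vT lT neg l0.
    by rewrite tE vl eqxx in tl.
  have vk := same_side_eq _ _ HT _ _ _ _ vT kT pos A0.
  by rewrite tE vk eqxx in tk.
pose L := aff_orient (p l) (p k).
have Li : aval L (p i) = o i l k by rewrite aff_orientE -orient_rot.
have Lj : aval L (p j) = - o j k l.
  by rewrite aff_orientE orient_swap -orient_rot.
have Lk : aval L (p k) = 0 by rewrite aff_orientE /orient; ring.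
have Ll : aval L (p l) = 0 by rewrite aff_orientE /orient; ring.
have Lx : 0 <= aval L x.
  apply: (hull_ge0 _ _ _ _ hx) => v; rewrite !inE.
  by move=> /orP[/orP[]|] /eqP ->; rewrite ?Li ?Ll ?Lk // ltW.
have meet m : (m == k) || (m == l) -> [set i; j; m]%SET \in T ->
    hull p [set i; j; m]%SET x -> hull p ([set i; l; k] :&: t)%SET x.
  move=> mkl mT hm.
  have hI : hull p ([set i; j; m] :&: t)%SET x.
    by case: HT => _ /(_ _ _ mT tT) <-.
  have Lm : aval L (p m) = 0 by case/orP: mkl => /eqP ->.
  have [jt|jt] := boolP (j \in t); last first.
    apply: hullS hI; apply/fintype.subsetP => v; rewrite !inE => /andP[vm vt].
    rewrite vt andbT; case/orP: vm => [/orP[]|].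
    - by move=> ->.
    - by move=> /eqP vj; rewrite -vj vt in jt.
    - by move=> /eqP ->; case/orP: mkl => ->; rewrite ?orbT.
  have it : i \notin t by apply/negP => it; apply: not_both.
  have Lneg v : v \in ([set i; j; m] :&: t)%SET -> aval L (p v) <= 0.
    rewrite !inE => /andP[/orP[/orP[]|] /eqP -> vt].
    - by rewrite vt in it.
    - by rewrite Lj oppr_le0 ltW.
    - by rewrite Lm.
  apply: hullS (hull_face _ _ _ _ hI Lneg Lx).
  apply/fintype.subsetP => v; rewrite !inE => /andP[/andP[vm vt] Lv].
  rewrite vt andbT; case/orP: vm => [/orP[]|] /eqP vE; rewrite vE ?eqxx //.
    by move: Lv; rewrite vE Lj oppr_eq0 gt_eqF.
  by case/orP: mkl => ->; rewrite ?orbT.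
have [h|h] := quad_cover _ _ _ _ _ _ Q hx.
  by apply: (meet k) => //; rewrite eqxx.
by apply: (meet l) => //; rewrite eqxx orbT.
Qed.

(** The two new triangles lie on opposite sides of the line [k l], so a common
    point is on that line. *)
Lemma flip_new_meet i j k l x : convex_quad p i j k l ->
  hull p [set i; l; k]%SET x -> hull p [set j; k; l]%SET x ->
  hull p ([set i; l; k] :&: [set j; k; l])%SET x.
Proof.
move=> [A0 B0 C0 D0] hi hj.
pose L := aff_orient (p l) (p k).
have Li : aval L (p i) = o i l k by rewrite aff_orientE -orient_rot.
have Lj : aval L (p j) = - o j k l.
  by rewrite aff_orientE orient_swap -orient_rot.
have Lk : aval L (p k) = 0 by rewrite aff_orientE /orient; ring.
have Ll : aval L (p l) = 0 by rewrite aff_orientE /orient; ring.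
have Lx : 0 <= aval L x.
  apply: (hull_ge0 _ _ _ _ hi) => v; rewrite !inE.
  by move=> /orP[/orP[]|] /eqP ->; rewrite ?Li ?Ll ?Lk // ltW.
have Lneg v : v \in [set j; k; l]%SET -> aval L (p v) <= 0.
  rewrite !inE => /orP[/orP[]|] /eqP ->; rewrite ?Lk ?Ll //.
  by rewrite Lj oppr_le0 ltW.
apply: hullS (hull_face _ _ _ _ hj Lneg Lx).
apply/fintype.subsetP => v; rewrite !inE => /andP[/orP[/orP[]|] /eqP ->];
  rewrite ?eqxx ?orbT //.
by rewrite Lj oppr_eq0 gt_eqF.
Qed.

Lemma flip_triangulation i j k l : convex_quad p i j k l ->
  [set i; j; k]%SET \in T -> [set i; j; l]%SET \in T ->
  triangulation p (flip i j k l).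
Proof.
move=> Q kT lT; have [A0 B0 C0 D0] := Q; have Q' := convex_quad_sym _ _ _ _ _ Q.
have HT' := HT; case: HT' => H3 HI HV HC.
have card3 a b c : 0 < o a b c ->
    #|[set a; b; c]%SET| = 3%N /\ ~ collinear p [set a; b; c]%SET.
  move=> o0; have [ab bc ac] := orient_neq _ _ _ _ (lt0r_neq0 o0).
  split; last by apply/orient_noncollinear; exact: lt0r_neq0.
  rewrite finset.setUC cardsU1 cards2 ab !inE ![c == _]eq_sym.
  by rewrite (negPf ac) (negPf bc).
have new1 : [set i; l; k]%SET \in flip i j k l by rewrite !inE eqxx.
have new2 : [set j; k; l]%SET \in flip i j k l by rewrite !inE eqxx orbT.
have old t : t \in T -> t != [set i; j; k]%SET -> t != [set i; j; l]%SET ->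
    t \in flip i j k l.
  by move=> tT tk tl; rewrite !inE tT (negPf tk) (negPf tl) orbT.
have kT' : [set j; i; k]%SET \in T by rewrite set3_swap.
have lT' : [set j; i; l]%SET \in T by rewrite set3_swap.
split.
- move=> t /flipP[->|->|[tT _ _]]; [exact: card3|exact: card3|exact: H3].
- have sub t t' : t \in flip i j k l -> t' \in flip i j k l ->
      forall x, hull p t x -> hull p t' x -> hull p (t :&: t')%SET x.
    move=> /flipP[->|->|[tT tk tl]] /flipP[->|->|[t'T t'k t'l]] x hx hx'.
    + by rewrite finset.setIid.
    + exact: flip_new_meet.
    + exact: (flip_meet i j k l).
    + by rewrite finset.setIC; apply: flip_new_meet.
    + by rewrite finset.setIid.
    + by apply: (flip_meet j i l k); rewrite // set3_swap.
    + by rewrite finset.setIC; apply: (flip_meet i j k l).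
    + by rewrite finset.setIC; apply: (flip_meet j i l k); rewrite // set3_swap.
    + by rewrite -(HI _ _ tT t'T).
  move=> t t' tT t'T; apply/seteqP; split=> [x [hx hx']|x hx].
    exact: sub.
  by split; apply: hullS hx; [exact: subsetIl | exact: subsetIr].
- move=> v; have [t tT vt] := HV v.
  have [tk|tk] := eqVneq t [set i; j; k]%SET.
    move: vt; rewrite tk !inE => /orP[/orP[]|] /eqP ->.
    + by exists [set i; l; k]%SET; rewrite ?new1 // !inE eqxx.
    + by exists [set j; k; l]%SET; rewrite ?new2 // !inE eqxx.
    + by exists [set i; l; k]%SET; rewrite ?new1 // !inE eqxx !orbT.
  have [tl|tl] := eqVneq t [set i; j; l]%SET.
    move: vt; rewrite tl !inE => /orP[/orP[]|] /eqP ->.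
    + by exists [set i; l; k]%SET; rewrite ?new1 // !inE eqxx.
    + by exists [set j; k; l]%SET; rewrite ?new2 // !inE eqxx.
    + by exists [set j; k; l]%SET; rewrite ?new2 // !inE eqxx !orbT.
  by exists t => //; apply: old.
- apply/seteqP; split=> [x [t _]|x].
    by apply: hullS; apply/fintype.subsetP => v _; rewrite inE.
  have sets : [/\ [set k; i; j]%SET = [set i; j; k]%SET,
      [set k; l; j]%SET = [set j; k; l]%SET, [set k; l; i]%SET = [set i; l; k]%SET,
      [set l; j; i]%SET = [set i; j; l]%SET & 
      [set l; k; j]%SET = [set j; k; l]%SET /\ [set l; k; i]%SET = [set i; l; k]%SET].
    by do !split; apply/setP => v; rewrite !inE; do !case: (_ == _).
  have [E1 E2 E3 E4 [E5 E6]] := sets.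
  rewrite -HC => -[t /= tT hx].
  have [tk|tk] := eqVneq t [set i; j; k]%SET.
    rewrite tk in hx.
    have := quad_cover p k l j i x (convex_quad_diag _ _ _ _ _ Q).
    rewrite E1 E2 E3 => /(_ hx)[h|h]; first by exists [set j; k; l]%SET.
    by exists [set i; l; k]%SET.
  have [tl|tl] := eqVneq t [set i; j; l]%SET.
    rewrite tl in hx.
    have := quad_cover p l k i j x (convex_quad_diag _ _ _ _ _ Q').
    rewrite E4 E5 E6 => /(_ hx)[h|h]; first by exists [set i; l; k]%SET.
    by exists [set j; k; l]%SET.
  by exists t => //; apply: old.
Qed.

Lemma flip_sum (F : {set 'I_n} -> R) i j k l : convex_quad p i j k l ->
  [set i; j; k]%SET \in T -> [set i; j; l]%SET \in T ->
  \sum_(t in T) F t - \sum_(t in flip i j k l) F t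
  = F [set i; j; k]%SET + F [set j; i; l]%SET
    - (F [set i; l; k]%SET + F [set j; k; l]%SET).
Proof.
move=> [A0 B0 C0 D0] kT lT; rewrite (set3_swap i j l).
have [ij jk ik] := orient_neq _ _ _ _ (lt0r_neq0 A0).
have [_ il jl] := orient_neq _ _ _ _ (lt0r_neq0 B0).
have [_ lk _] := orient_neq _ _ _ _ (lt0r_neq0 C0).
have n1T : [set i; l; k]%SET \notin T.
  apply/negP => nT; case/eqP: jl.
  have kT' : [set k; i; j]%SET \in T by rewrite set3_rot.
  have nT' : [set k; i; l]%SET \in T by rewrite set3_rot.
  have kij : 0 < o k i j by rewrite orient_rot.
  have kil : 0 < o k i l by rewrite orient_rot.
  exact: (same_side_eq _ _ HT _ _ _ _ kT' nT' kij kil).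
have n2T : [set j; k; l]%SET \notin T.
  apply/negP => nT; case/eqP: il.
  have kT' : [set j; k; i]%SET \in T by rewrite -set3_rot.
  have jki : 0 < o j k i by rewrite -orient_rot.
  exact: (same_side_eq _ _ HT _ _ _ _ kT' nT jki D0).
have kl_neq : [set i; j; l]%SET != [set i; j; k]%SET by rewrite set3_eq.
have n_neq : [set i; l; k]%SET != [set j; k; l]%SET.
  apply/eqP => /(congr1 (fun A : {set 'I_n} => i \in A)).
  by rewrite !inE eqxx (negPf ij) (negPf ik) (negPf il).
set t1 := [set i; j; k]%SET in kT kl_neq *; set t2 := [set i; j; l]%SET in lT kl_neq *.
have -> : \sum_(t in T) F t = F t1 + F t2 + \sum_(t in T :\: [set t1; t2]) F t.
  rewrite (big_setD1 t1) //= (big_setD1 t2) /=; last by rewrite !inE kl_neq.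
  by rewrite addrA finset.setDDl.
have -> : \sum_(t in flip i j k l) F t
    = F [set i; l; k]%SET + F [set j; k; l]%SET + \sum_(t in T :\: [set t1; t2]) F t.
  rewrite /flip -finset.setUA big_setU1 /=; last first.
    by rewrite !inE negb_or n_neq (negPf n1T) andbF.
  rewrite big_setU1 /=; last by rewrite !inE (negPf n2T) andbF.
  by rewrite addrA.
ring.
Qed.

End Flip.

(** * From convexity across edges to the convex envelope *)

Section LocalToGlobal.
Context {R : realType} {n : nat}.
Variables (p : 'I_n -> plane R) (s : 'I_n -> R) (T : {set {set 'I_n}}).
Hypotheses (p_inj : injective p) (HT : triangulation p T).
Implicit Types (t : {set 'I_n}) (i j k l v : 'I_n) (L D : R * plane R) (x y : plane R).

Local Notation o i j k := (orient (p i) (p j) (p k)).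

Definition lin3 (a : R) L (b : R) D (c : R) (M : R * plane R) : R * plane R :=
  (a * L.1 + b * D.1 + c * M.1, a *: L.2 + b *: D.2 + c *: M.2).

Lemma aval_lin3 a L b D c M x :
  aval (lin3 a L b D c M) x = a * aval L x + b * aval D x + c * aval M x.
Proof. rewrite /aval /dot /lin3 /= /GRing.scale /=; ring. Qed.

(** The interpolant of [s] on [T] has no concave crease. *)
Definition convex_across_edges : Prop := forall i j k l,
  [set i; j; k]%SET \in T -> [set i; j; l]%SET \in T ->
  0 < o i j k -> o i j l < 0 -> lift_det p s i j k l <= 0.

Lemma orient_parallel x y (a b : plane R) : x != y ->
  orient x y a = 0 -> orient x y b = 0 -> orient a b x = 0.
Proof.
move=> xy xa xb; apply/eqP; apply: contraNT xy => o0.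
have E1 : (y.1 - x.1) * orient a b x
    = (a.1 - x.1) * orient x y b - (b.1 - x.1) * orient x y a.
  by rewrite /orient; ring.
have E2 : (y.2 - x.2) * orient a b x
    = (a.2 - x.2) * orient x y b - (b.2 - x.2) * orient x y a.
  by rewrite /orient; ring.
move: E1 E2; rewrite xa xb !mulr0 subrr => /eqP E1 /eqP E2.
move: E1 E2; rewrite !mulf_eq0 (negPf o0) !orbF !subr_eq0 => /eqP E1 /eqP E2.
by apply/eqP; case: (x) (y) E1 E2 => [? ?] [? ?] /= -> ->.
Qed.

Lemma near_line_neq0 (a b : R) : (a != 0) || (b != 0) ->
  \forall d \near 0^'+, (1 - d) * a + d * b != 0.
Proof.
have [a0|a0|<-] := ltgtP 0 a.
- by move=> _; apply: filterS (near_line_gt0 a b a0) => d; exact: lt0r_neq0.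
- move=> _; rewrite -oppr_gt0 in a0.
  apply: filterS (near_line_gt0 _ (- b) a0) => d.
  by rewrite !mulrN -opprD oppr_gt0; exact: ltr0_neq0.
rewrite ?eqxx /= => b0; apply: filterS (nbhs_right_gt 0) => d d0.
by rewrite mulr0 add0r mulf_neq0 // gt_eqF.
Qed.

(** The segment from such a point to the vertex [j] meets no other vertex, so it
    passes from one triangle to another only at interior points of edges. *)
Lemma generic_point t j : t \in T ->
  exists2 x, hull p t x & forall v, v != j -> orient (p j) (p v) x != 0.
Proof.
move=> tT; have [i it] : exists i, i \in t.
  case: HT => H _ _ _; have [t3 _] := H _ tT.
  by apply/set0Pn; rewrite -card_gt0 t3.
have [b [c [tE o0]]] := tri_vertex _ _ HT _ _ tT it.
(* A side of [t] whose line misses the vertex [j]: no line through [p j] contains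
   it, so each excludes only one of its points. *)
have [a1 [b1 [a1t b1t abj]]] : exists a b, [/\ a \in t, b \in t & o a b j != 0].
  apply: contrapT => no.
  have z a d : a \in t -> d \in t -> o a d j = 0.
    by move=> at_ dt; apply: contrapT => /eqP adj; apply: no; exists a, d.
  have bt : b \in t by rewrite tE !inE eqxx orbT.
  have ct : c \in t by rewrite tE !inE eqxx !orbT.
  have := z _ _ it bt; have := z _ _ bt ct; have := z _ _ ct it => E1 E2 E3.
  have : o i b c = o i b j + o b c j + o c i j by rewrite /orient; ring.
  by rewrite E1 E2 E3 !addr0 => E; rewrite E ltxx in o0.
have N v : \forall d \near (0 : R)^'+, v != j ->
    (1 - d) * o j v a1 + d * o j v b1 != 0.
  have [->|vj] := eqVneq v j; first by apply: nearW.
  apply: filterS (near_line_neq0 (o j v a1) (o j v b1) _) => //.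
  apply: contra_neqT abj; rewrite negb_or !negbK => /andP[/eqP Ea /eqP Eb].
  apply: orient_parallel Ea Eb.
  by rewrite (inj_eq p_inj) eq_sym.
have {}N : \forall d \near (0 : R)^'+, forall v, v != j ->
    (1 - d) * o j v a1 + d * o j v b1 != 0 by apply: filter_forall.
have N1 : \forall d \near (0 : R)^'+, d < 1 by apply: nbhs_right_lt; rewrite ltr01.
have N0 := nbhs_right_gt (0 : R).
have [d [Nd [d1 d0]]] := filter_ex (filterI N (filterI N1 N0)).
exists (p a1 + d *: (p b1 - p a1)).
  apply: hull_line; [by rewrite !ltW | exact: hull_vertex | exact: hull_vertex].
by move=> v vj; rewrite orient_line; exact: Nd.
Qed.

(** A union of finitely many triangles is closed, so a segment that starts in it has
    a last point in it. *)
Lemma last_point (S : {set {set 'I_n}}) x y : S \subset T ->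
  (exists2 t, t \in S & hull p t x) ->
  exists d : R, [/\ 0 <= d <= 1, exists2 t, t \in S & hull p t (x + d *: (y - x))
    & forall e, d < e <= 1 -> forall t, t \in S -> ~ hull p t (x + e *: (y - x))].
Proof.
move=> /fintype.subsetP ST [t0 t0S xt0].
pose A := [set d : R | 0 <= d <= 1 /\ exists2 t, t \in S & hull p t (x + d *: (y - x))].
have A0 : A 0.
  by split; [rewrite lexx ler01 | exists t0 => //; rewrite scale0r addr0].
have A1 : ubound A 1 by move=> d [/andP[_ d1] _].
have Asup : has_sup A by split; [exists 0 | exists 1].
set d := sup A.
have d0 : 0 <= d by apply: ub_le_sup => //; exists 1.
have d1 : d <= 1 by apply: ge_sup => //; exists 0.
have after e : d < e <= 1 -> forall t, t \in S -> ~ hull p t (x + e *: (y - x)).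
  move=> /andP[de e1] t tS h; have : A e.
    by split; [rewrite e1 andbT (le_trans d0) // ltW | exists t].
  by move=> /(ub_le_sup (ex_intro _ 1 A1)); rewrite -/d leNgt de.
exists d; split=> //; first by rewrite d0 d1.
have [dz|dnz] := eqVneq d 0; first by exists t0 => //; rewrite dz scale0r addr0.
have dpos : 0 < d by rewrite lt_neqAle eq_sym dnz d0.
set z := x + d *: (y - x).
apply: contrapT => no.
have : forall t, \forall e \near (0 : R)^'+, t \in S -> ~ hull p t (z + e *: (x - z)).
  move=> t; have [tS|tS] := boolP (t \in S); last by apply: nearW.
  case: (near_hull_tri _ _ HT t z x (ST _ tS)) => [[h _]|h].
    by exfalso; apply: no; exists t.
  by apply: filterS h => e h _.
(* By maximality of [d] there are points of the union just before [z], but the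
   triangles that do not contain [z] avoid a whole segment before it. *)
move=> /filter_forall -[e /= e0 He].
have [a [a01 [t tS ta]] da] := sup_adherent (mulr_gt0 e0 dpos) Asup.
have ad : a <= d by apply: ub_le_sup; [exists 1 | split=> //; exists t].
have {}ad : a < d.
  rewrite lt_neqAle ad andbT; apply/eqP => E; apply: no; exists t => //.
  by rewrite /z -E.
pose f := (d - a) / d.
have f0 : 0 < f by rewrite divr_gt0 // subr_gt0.
have fe : `|0 - f| < e.
  by rewrite sub0r normrN gtr0_norm // ltr_pdivrMr // ltrBlDl -ltrBlDr.
apply: (He f fe f0 t tS).
have -> : z + f *: (x - z) = x + a *: (y - x).
  apply: plane_eq => L; rewrite /f /z !aval_line.
  by field.
exact: ta.
Qed.

Lemma interpolant t : t \in T ->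
  exists L, forall i, i \in t -> aval L (p i) = s i.
Proof.
move=> tT; have [i it] : exists i, i \in t.
  case: HT => H _ _ _; have [t3 _] := H _ tT.
  by apply/set0Pn; rewrite -card_gt0 t3.
have [j [k [-> o0]]] := tri_vertex _ _ HT _ _ tT it.
have zi (a b : plane R) : orient a b a = 0 by rewrite /orient; ring.
have zj (a b : plane R) : orient a b b = 0 by rewrite /orient; ring.
exists (lin3 (s i / o i j k) (aff_orient (p j) (p k)) (s j / o i j k)
  (aff_orient (p k) (p i)) (s k / o i j k) (aff_orient (p i) (p j))) => v.
rewrite !inE aval_lin3 !aff_orientE => /orP[/orP[]|] /eqP ->; rewrite !zi ?zj.
- by rewrite -(orient_rot (p i)) !mulr0 !addr0 divfK // gt_eqF.
- by rewrite (orient_rot (p k)) !mulr0 addr0 add0r divfK // gt_eqF.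
- by rewrite !mulr0 !add0r divfK // gt_eqF.
Qed.

(** Across a locally convex edge the affine extension of [s] can only increase
    on the far side. *)
Lemma cross_edge L D i j k l x : convex_across_edges ->
  [set i; j; k]%SET \in T -> [set i; j; l]%SET \in T ->
  0 < o i j k -> o i j l < 0 -> 0 <= orient (p i) (p j) x ->
  (forall v, v \in [set i; j; k]%SET -> aval D (p v) = s v) ->
  (forall v, v \in [set i; j; l]%SET -> aval L (p v) = s v) ->
  aval L x <= aval D x.
Proof.
move=> lc kT lT ok nl ox HD HL.
have Di : aval D (p i) = s i by apply: HD; rewrite !inE eqxx.
have Dj : aval D (p j) = s j by apply: HD; rewrite !inE eqxx orbT.
have Dk : aval D (p k) = s k by apply: HD; rewrite !inE eqxx orbT.
have Li : aval L (p i) = s i by apply: HL; rewrite !inE eqxx.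
have Lj : aval L (p j) = s j by apply: HL; rewrite !inE eqxx orbT.
have Ll : aval L (p l) = s l by apply: HL; rewrite !inE eqxx orbT.
have := lc _ _ _ _ kT lT ok nl; rewrite (lift_det_touch _ L) /lift_det.
rewrite Li Lj Ll !subrr !mul0r subrr add0r subr0 nmulr_lle0 // => sk.
have := aval_edge p (D - L) i j k x.
rewrite !avalB Di Dj Dk Li Lj !subrr => /(_ erefl erefl) E.
rewrite -subr_ge0 -(pmulr_lge0 _ ok) E; exact: mulr_ge0.
Qed.

(** Follow a generic segment towards the vertex [j] from a triangle whose affine
    function is largest at [j]: every crossed edge keeps it largest, so the
    triangles at [j] attain the maximum, which is therefore [s j]. *)
Lemma convex_across_edges_supported : convex_across_edges -> supported p s T.
Proof.
move=> lc.
have [N NE] : exists N : {set 'I_n} -> R * plane R,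
    forall t, t \in T -> forall i, i \in t -> aval (N t) (p i) = s i.
  have H t : exists L, t \in T -> forall i, i \in t -> aval L (p i) = s i.
    have [/interpolant[L HL]|tT] := boolP (t \in T); first by exists L.
    by exists 0.
  by have [N HN] := choice H; exists N.
suff le_s t j : t \in T -> aval (N t) (p j) <= s j.
  by move=> t tT; exists (N t); split=> [j|]; [exact: le_s | exact: NE].
move=> tT; rewrite leNgt; apply/negP => big.
pose tm := [arg max_(x > t | x \in T) aval (N x) (p j)]%O.
have [tmT tmax] : tm \in T /\ forall t', t' \in T ->
    aval (N t') (p j) <= aval (N tm) (p j).
  by rewrite /tm; case: arg_maxP.
set M := aval (N tm) (p j) in tmax.
have Mj : s j < M by apply: lt_le_trans big _; exact: tmax.
pose S := [set x in T | aval (N x) (p j) == M]%SET.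
have ST : S \subset T by apply/fintype.subsetP => x; rewrite inE => /andP[].
have STin t' : t' \in S -> t' \in T by rewrite inE => /andP[].
have SM t' : t' \in S -> aval (N t') (p j) = M by rewrite inE => /andP[_ /eqP].
have maxS t' : t' \in T -> M <= aval (N t') (p j) -> t' \in S.
  by move=> t'T t'M; rewrite inE t'T eq_le t'M tmax.
have Sj t' : t' \in S -> j \notin t'.
  move=> xS; apply/negP => jx; move: Mj.
  by rewrite -(SM _ xS) (NE _ (STin _ xS) _ jx) ltxx.
have tmS : tm \in S by apply: maxS.
(* [z] is the last point in a triangle where the maximum is attained, and [t2] is
   the triangle that the segment enters there. *)
have [x tx gen] := generic_point _ j tmT.
have ex0 : exists2 t, t \in S & hull p t x by exists tm.
have [d [/andP[d0 d1] [t1 t1S h1] after]] := last_point _ x (p j) ST ex0.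
have t1T := STin _ t1S.
set z := x + d *: (p j - x) in h1.
have dlt1 : d < 1.
  rewrite lt_neqAle d1 andbT; apply/eqP => E.
  have zj : z = p j by rewrite /z E scale1r addrC subrK.
  by move: (Sj _ t1S); rewrite (hull_tri_vertex _ _ HT) // -zj.
have not_vertex v : v != j -> z != p v.
  move=> vj; apply: contra_neq (gen _ vj) => E.
  have := orient_line (p j) (p v) x (p j) d; rewrite -/z E.
  have -> : orient (p j) (p v) (p v) = 0 by rewrite /orient; ring.
  have -> : orient (p j) (p v) (p j) = 0 by rewrite /orient; ring.
  rewrite mulr0 addr0 => /esym/eqP; rewrite mulf_eq0 subr_eq0 eq_sym.
  by rewrite (lt_eqF dlt1) => /eqP.
have hz : hull p [set: 'I_n] z.
  by apply: hullS h1; apply/fintype.subsetP => v _; rewrite inE.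
have hj : hull p [set: 'I_n] (p j) by apply: hull_vertex; rewrite inE.
have [t2 t2T [h2 near2]] := germ_tri _ _ HT _ _ hz hj.
have N1 : \forall e \near (0 : R)^'+, e < 1 by apply: nbhs_right_lt; rewrite ltr01.
have [e [he [e1 e0]]] := filter_ex (filterI near2 (filterI N1 (nbhs_right_gt 0))).
have t2S : t2 \notin S.
  apply/negP => t2S; pose f := d + e * (1 - d).
  have f1 : d < f <= 1.
    rewrite /f ltrDl mulr_gt0 ?subr_gt0 //=.
    rewrite -lerBrDl ler_piMl ?subr_ge0 //; exact: ltW.
  apply: (after f f1 t2 t2S).
  have -> : x + f *: (p j - x) = z + e *: (p j - z).
    by apply: plane_eq => L; rewrite /z /f !aval_line; ring.
  exact: he.
have hI : hull p (t1 :&: t2)%SET z by case: HT => _ /(_ _ _ t1T t2T) <-.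
(* The common face of the two triangles contains [z], which is not a vertex. *)
have [a [b [ab aI bI]]] : exists a b, [/\ a != b, a \in (t1 :&: t2)%SET
    & b \in (t1 :&: t2)%SET].
  apply: contrapT => no.
  have [w [w0 wI w1 wE]] := hull_aval _ _ _ hI.
  have [a aI] : exists a, a \in (t1 :&: t2)%SET.
    apply: contrapT => na; have : \sum_v w v = 0.
      by rewrite big1 // => v _; apply: wI; apply/negP => vI; apply: na; exists v.
    by move=> /eqP; rewrite w1 oner_eq0.
  have aj : a != j.
    apply/eqP => aj; move: aI; rewrite aj inE => /andP[jt1 _].
    by move: (Sj _ t1S); rewrite jt1.
  have wa v : v != a -> w v = 0.
    by move=> va; apply: wI; apply/negP => vI; apply: no; exists v, a.
  case/eqP: (not_vertex a aj); apply: plane_eq => L.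
  rewrite wE (bigD1 a) //= big1 ?addr0 => [|v va]; last by rewrite wa ?mul0r.
  suff -> : w a = 1 by rewrite mul1r.
  by rewrite -w1 (bigD1 a) //= big1 ?addr0 // => v va; exact: wa.
have [at1 at2] : a \in t1 /\ a \in t2 by move: aI; rewrite inE => /andP[].
have [bt1 bt2] : b \in t1 /\ b \in t2 by move: bI; rewrite inE => /andP[].
have step a' b' c' d' : t1 = [set a'; b'; c']%SET -> t2 = [set a'; b'; d']%SET ->
    0 < o a' b' d' -> False.
  move=> E1 E2 pos.
  have cd : c' != d'.
    by apply: contraNneq t2S => cd; rewrite E2 -cd -E1.
  have cT : [set a'; b'; c']%SET \in T by rewrite -E1.
  have dT : [set a'; b'; d']%SET \in T by rewrite -E2.
  have neg : o a' b' c' < 0.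
    by apply: (opposite_sides _ _ HT _ _ _ _ dT cT pos); rewrite eq_sym.
  have [_ bd ad] := orient_neq _ _ _ _ (lt0r_neq0 pos).
  have za : orient (p a') (p b') z = 0.
    rewrite -aff_orientE; apply: (hull_eq0 _ _ _ _ hI) => v.
    rewrite E1 E2 !inE aff_orientE => /andP[/orP[/orP[]|] /eqP ->].
    - by move=> _; rewrite /orient; ring.
    - by move=> _; rewrite /orient; ring.
    - rewrite (negPf cd) orbF => /orP[] /eqP ->; rewrite /orient; ring.
  have oj : 0 <= orient (p a') (p b') (p j).
    have : 0 <= orient (p a') (p b') (z + e *: (p j - z)).
      rewrite -aff_orientE; apply: (hull_ge0 _ _ _ _ he) => v.
      rewrite E2 !inE aff_orientE => /orP[/orP[]|] /eqP ->.
      - by rewrite (_ : o a' b' a' = 0) // /orient; ring.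
      - by rewrite (_ : o a' b' b' = 0) // /orient; ring.
      - exact: ltW.
    by rewrite orient_line za mulr0 add0r (pmulr_rge0 _ e0).
  case/negP: t2S; apply: maxS => //; rewrite -(SM _ t1S).
  apply: (cross_edge (N t1) (N t2) _ _ _ _ _ lc dT cT pos neg oj).
  - by rewrite -E2; exact: NE.
  - by rewrite -E1; exact: NE.
have [c1 E1] := tri_edge _ _ HT _ _ _ t1T at1 bt1 ab.
have [c2 E2] := tri_edge _ _ HT _ _ _ t2T at2 bt2 ab.
have c2T : [set a; b; c2]%SET \in T by rewrite -E2.
have [neg|pos] : o a b c2 < 0 \/ 0 < o a b c2.
    by apply/orP; rewrite -neq_lt; apply: tri_orient c2T.
  have neg' : 0 < o b a c2 by rewrite orient_swap oppr_gt0.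
  by apply: (step b a c1 c2 _ _ neg'); rewrite set3_swap.
exact: (step a b c1 c2 E1 E2 pos).
Qed.

End LocalToGlobal.

(** * Descent by flips *)

Section Descent.
Context {R : realType} {n : nat}.
Variables (p : 'I_n -> plane R) (s u : 'I_n -> R).
Implicit Types (T : {set {set 'I_n}}) (t : {set 'I_n}) (i j k l v : 'I_n)
  (L : R * plane R).

Local Notation o i j k := (orient (p i) (p j) (p k)).

(** If one of the two other triangles were not positively oriented, one end of the
    edge [i j] would be a convex combination of the other three points, and the
    convexity of [s] would make the crease convex; to see this, subtract from [s]
    an affine function that supports it at that end. *)
Lemma concave_convex_quad i j k l :
  (forall v, exists L, aval L (p v) = s v /\ forall w, aval L (p w) <= s w) ->
  0 < o i j k -> 0 < o j i l -> 0 < lift_det p s i j k l -> convex_quad p i j k l.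
Proof.
move=> touch A0 B0; apply: contraPP => nQ; apply/negP; rewrite -leNgt.
have E L : lift_det p s i j k l
    = (s i - aval L (p i)) * o j k l + (s j - aval L (p j)) * o i l k
      - (s k - aval L (p k)) * o j i l - (s l - aval L (p l)) * o i j k.
  by rewrite (lift_det_touch _ L) /lift_det /orient; ring.
have Bk L : (forall w, aval L (p w) <= s w) -> 0 <= (s k - aval L (p k)) * o j i l.
  by move=> Ls; apply: mulr_ge0; [rewrite subr_ge0 | exact: ltW].
have Al L : (forall w, aval L (p w) <= s w) -> 0 <= (s l - aval L (p l)) * o i j k.
  by move=> Ls; apply: mulr_ge0; [rewrite subr_ge0 | exact: ltW].
have [C0|C0] := ltP 0 (o i l k); last first.
  have [L [Li Ls]] := touch i; rewrite (E L) Li subrr mul0r add0r.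
  rewrite subr_le0; apply: le_trans (Al _ Ls); rewrite subr_le0.
  apply: le_trans (Bk _ Ls).
  by apply: mulr_ge0_le0; [rewrite subr_ge0 | exact: C0].
have [D0|D0] := ltP 0 (o j k l); first by exfalso; apply: nQ; split.
have [L [Lj Ls]] := touch j; rewrite (E L) Lj subrr mul0r addr0.
rewrite subr_le0; apply: le_trans (Al _ Ls); rewrite subr_le0.
apply: le_trans (Bk _ Ls).
by apply: mulr_ge0_le0; [rewrite subr_ge0 | exact: D0].
Qed.

(** Twelve times the integral of the piecewise linear interpolant of [s]. *)
Definition interpolant_volume T : R :=
  \sum_(t in T) triple_sum (fun i j k => `|o i j k| * s k) t.

Lemma volume_tri i j k : 0 < o i j k ->
  triple_sum (fun i j k => `|o i j k| * s k) [set i; j; k]%SET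
  = 2 * (o i j k * (s i + s j + s k)).
Proof.
move=> o0; have [ij jk ik] := orient_neq _ _ _ _ (lt0r_neq0 o0).
rewrite triple_sum3 //.
have -> : o j i k = - o i j k by rewrite orient_swap.
have -> : o i k j = - o i j k by rewrite orient_swap_last.
have -> : o j k i = o i j k by rewrite -orient_rot.
have -> : o k i j = o i j k by rewrite orient_rot.
have -> : o k j i = - o i j k by rewrite /orient; ring.
by rewrite !normrN gtr0_norm //; ring.
Qed.

Lemma flip_volume T i j k l : triangulation p T -> convex_quad p i j k l ->
  [set i; j; k]%SET \in T -> [set i; j; l]%SET \in T ->
  interpolant_volume T - interpolant_volume (flip T i j k l)
  = 2 * lift_det p s i j k l.
Proof.
move=> HT Q kT lT; rewrite (flip_sum _ _ HT _ _ _ _ _ Q kT lT).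
have [A0 B0 C0 D0] := Q; rewrite !volume_tri // /lift_det /orient; ring.
Qed.

Lemma flip_energy_le T i j k l :
  (forall i, boundary (hull p [set: 'I_n]) (p i) -> u i = 0) ->
  triangulation p T -> convex_quad p i j k l ->
  [set i; j; k]%SET \in T -> [set i; j; l]%SET \in T ->
  0 < lift_det p s i j k l ->
  dirichlet_energy p s (flip T i j k l) u <= dirichlet_energy p s T u.
Proof.
move=> u_bd HT Q kT lT S0.
have HF := flip_triangulation _ _ HT _ _ _ _ Q kT lT.
rewrite !energy_triangles // ler_pM2l ?invr_gt0 ?ltr0n // -subr_ge0.
rewrite (flip_sum _ _ HT _ _ _ _ _ Q kT lT); have [A0 B0 C0 D0] := Q.
have tri a b c : 0 < o a b c ->
    tri_energy p s u [set a; b; c]%SET = triangle_energy p s u a b c.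
  by move=> o0; have [? ? ?] := orient_neq _ _ _ _ (lt0r_neq0 o0); apply: tri_energyE.
rewrite !tri // flip_energy //; apply: divr_ge0.
  by apply: mulr_ge0; [exact: ltW | exact: sqr_ge0].
by apply: ltW; do !apply: mulr_gt0.
Qed.

(** Since [w i = |p i| ^ 2 - 2 * s i], the power of a point [x] with respect to [i]
    is [|x| ^ 2 + 2 * (s i - x . p i)]. So if [x] lies in the power cells of all
    the vertices of [t], then [s i - x . p i] is the same least value at all of
    them, and the affine function with gradient [x] supports [s] there. *)
Lemma Delaunay_supported T :
  weighted_Delaunay p (fun i => (p i).1 ^+ 2 + (p i).2 ^+ 2 - 2 * s i) T ->
  supported p s T.
Proof.
move=> [HT _ HD] t tT; have [x cell] := HD t tT.
have [H3 _ _ _] := HT; have [t3 _] := H3 _ tT.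
have [a at_] : exists a, a \in t by apply/set0Pn; rewrite -card_gt0 t3.
have le i j : i \in t -> s i - dot x (p i) <= s j - dot x (p j).
  move=> /cell /(_ j); rewrite !enorm2 /dot /= => H.
  lra.
exists (s a - dot x (p a), x); rewrite /aval /=; split=> [i|i it].
  by rewrite -lerBrDr; exact: le.
apply/eqP; rewrite -(inj_eq (addIr (- dot x (p i)))) addrK eq_le.
by apply/andP; split; exact: le.
Qed.

End Descent.

Theorem mainTheorem9 (R : realType) (Omega : set (plane R))
    (Q : plane R -> 'M[R]_2) (s : plane R -> R)
    (n : nat) (p : 'I_n -> plane R) (u : 'I_n -> R) (T : {set {set 'I_n}})
    (HOmega : convex_C2_domain Omega)
    (HQ : Mdiv Omega Q)
    (Hs : parametrizes Omega Q s)
    (p_inj : injective p)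
    (p_Omega : forall i, Omega (p i))
    (p_ncol : ~ collinear p [set: 'I_n])
    (u_bd : forall i, boundary (hull p [set: 'I_n]) (p i) -> u i = 0)
    (HT : weighted_Delaunay p
            (fun i => (p i).1 ^+ 2 + (p i).2 ^+ 2 - 2 * s (p i)) T) :
  forall T' : {set {set 'I_n}}, triangulation p T' ->
    dirichlet_energy p (s \o p) T u <= dirichlet_energy p (s \o p) T' u.
Proof.
move=> T' HT'; have [tri_T _ _] := HT.
have ST : supported p (s \o p) T by apply: Delaunay_supported.
have touch v : exists L, aval L (p v) = (s \o p) v /\
    forall w, aval L (p w) <= (s \o p) w.
  have [_ _ /(_ v)[t tT vt] _] := tri_T.
  by have [L [Ls Le]] := ST _ tT; exists L; split; [exact: Le | exact: Ls].
(* The interpolant of least integral among the triangulations of no greater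
   energy: a flip across a concave crease would stay among them. *)
pose better X := `[< triangulation p X /\
  dirichlet_energy p (s \o p) X u <= dirichlet_energy p (s \o p) T' u >].
have better_T' : better T' by apply/asboolP; split.
have [X /asboolP[HX EX] minX] : exists2 X, better X & forall Y, better Y ->
    interpolant_volume p (s \o p) X <= interpolant_volume p (s \o p) Y.
  by case: (arg_minP (interpolant_volume p (s \o p)) better_T') => X; exists X.
have lcX : convex_across_edges p (s \o p) X.
  move=> i j k l kX lX k0 l0; rewrite leNgt; apply/negP => crease.
  have l0' : 0 < orient (p j) (p i) (p l) by rewrite orient_swap oppr_gt0.
  have quad := concave_convex_quad p _ i j k l touch k0 l0' crease.
  have better_flip : better (flip X i j k l).
    apply/asboolP; split; first exact: flip_triangulation.
    by apply: le_trans EX; apply: flip_energy_le.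
  have := minX _ better_flip.
  rewrite -subr_le0 (flip_volume _ _ _ _ _ _ _ HX quad kX lX).
  by rewrite leNgt mulr_gt0 ?ltr0n.
have SX := convex_across_edges_supported _ _ _ p_inj HX lcX.
by rewrite (supported_energy _ _ _ u_bd T X).
Qed.
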